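(* Let $G=(V,E)$ be a graph quasi-isometric to the hyperbolic plane, and let $n\ge 2$. Then the $O(n)$ model on $G$ with free boundary conditions has exponentially decaying pair correlations, at all temperatures. That is, for every $\beta>0$ there are constants $K<\infty$ and $\kappa>0$ such that for all vertices $u,v\in V$ the free-boundary pair correlation of $u$ and $v$ at inverse temperature $\beta$ is at most $K e^{-\kappa\, d(u,v)}$ in absolute value, where $d$ is the graph distance.
   Context: Quasi-isometry: two metric spaces $X$ and $Y$ are quasi-isometric if there is a map $\phi:X\to Y$ and positive constants $c,C$, independent of $x$ and $y$, such that $c\,d(x,y)-C\le d(\phi(x),\phi(y))\le C\,d(x,y)+C$ for all $x,y\in X$, and for every $y\in Y$ there is $x\in X$ with $d(\phi(x),y)\le C$. A graph is quasi-isometric to the hyperbolic plane if, when equipped with the graph metric (the distance between two vertices is the length of the shortest path between them), it is quasi-isometric to the hyperbolic plane with its standard metric. $O(n)$ model: every vertex $v$ of the graph is given a spin $s_v$, a unit vector in the sphere $\mathbb{S}^{n-1}\subset\mathbb{R}^n$. The Hamiltonian is $H=-\sum_{\{v,u\}\in E}\langle s_v,s_u\rangle$, where $\langle\cdot,\cdot\rangle$ is the Euclidean inner product. Take the exhaustion of the graph by the balls $B_r$ of radius $r$ in the graph distance (around a fixed vertex), and let $H_r$ be the Hamiltonian with the sum restricted to edges inside $B_r$ (free boundary conditions). The pair correlation of $u$ and $v$ at inverse temperature $\beta$ is $$\lim_{r\to\infty}\frac{\int\langle s_u,s_v\rangle \exp(-\beta H_r(s))\,ds}{\int \exp(-\beta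 H_r(s))\,ds},$$ where the integrals are over $(\mathbb{S}^{n-1})^{|B_r|}$ with respect to the product of the uniform measures on the spheres.
   Formalization: The graph is additionally assumed connected with bounded degree; with unbounded degrees the claim fails (blow up each vertex of a hyperbolic tiling into rapidly growing clusters, n=2), and the bound is stated for the limsup of absolute correlations, which equals the limit's when it exists. *)

(* Defs.v *)
From HB Require Import structures.
From mathcomp Require Import all_boot all_order all_algebra finmap.
From mathcomp Require Import all_classical all_reals all_analysis.

Set Implicit Arguments.
Unset Strict Implicit.
Unset Printing Implicit Defensive.

Import Order.TTheory GRing.Theory Num.Theory.
Import numFieldNormedType.Exports.

Local Open Scope classical_set_scope.
Local Open Scope ring_scope.

Section QuasiIsometry.
Variables (R : realType) (X Y : Type) (dX : X -> X -> R) (dY : Y -> Y -> R).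

Definition quasi_isometric : Prop :=
  exists (phi : X -> Y) (c C : R), [/\ 0 < c, 0 < C,
    forall x x', c * dX x x' - C <= dY (phi x) (phi x') <= C * dX x x' + C
  & forall y, exists x, dY (phi x) y <= C].

End QuasiIsometry.

Section HyperbolicPlane.
Variable R : realType.

(* The upper half-plane model. *)
Definition hplane := {z : R * R | 0 < z.2}.

Definition arcosh (t : R) : R := ln (t + Num.sqrt (t ^+ 2 - 1)).

Definition hdist (z w : hplane) : R :=
  let: (x1, y1) := sval z in let: (x2, y2) := sval w in
  arcosh (1 + ((x1 - x2) ^+ 2 + (y1 - y2) ^+ 2) / (2 * y1 * y2)).

End HyperbolicPlane.

(* A graph is a symmetric irreflexive adjacency relation on an arbitrary,
   in particular possibly infinite, type of vertices. *)
Section Graph.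
Variables (V : choiceType) (adj : rel V).

Definition walk (u v : V) (k : nat) : Prop :=
  exists p : seq V, [/\ path adj u p, last u p = v & size p = k].

Definition connected_graph : Prop := forall u v, exists k, walk u v k.

Definition bounded_degree : Prop :=
  exists D : nat, forall v, ([set w | adj v w] #<= `I_D)%card.

(* The value is 0 when no walk joins u to v. *)
Definition gdist (u v : V) : nat :=
  xget 0%N [set k | walk u v k /\ forall m, walk u v m -> (k <= m)%N].

(* fset_set sends infinite sets to the empty one; balls are finite in a
   connected graph of bounded degree. *)
Definition gball (o : V) (r : nat) : {fset V} :=
  fset_set [set v | (gdist o v <= r)%N].

End Graph.

Section Spins.
Variables (R : realType) (n : nat).

(* Tuples rather than row vectors, because the former carry the product (here,
   the Borel) sigma-algebra. *)
Definition spin := n.-tuple (measurableTypeR R).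

Definition dotp (s t : spin) : R := \sum_(i < n) tnth s i * tnth t i.

Definition sphere : set spin := [set s | dotp s s = 1].

Definition mxapp (A : 'M[R]_n) (s : spin) : spin :=
  [tuple \sum_(j < n) A i j * tnth s j | i < n].

(* The uniform measure on the sphere is the unique Borel probability measure
   carried by the sphere that is invariant under the orthogonal group. *)
Definition uniform_on_sphere (sigma : probability spin R) : Prop :=
  sigma sphere = 1%E /\
  forall A : 'M[R]_n, A *m A^T = 1%:M ->
    forall B : set spin, measurable B -> sigma (mxapp A @^-1` B) = sigma B.

End Spins.

Section OnModel.
Variables (R : realType) (V : choiceType) (adj : rel V) (n : nat).
Variable sigma : probability (spin R n) R.

(* The integral of F over the spins at the vertices listed in l, with respect
   to the product of copies of sigma on spheres, written as an iterated
   integral; the spins at the other vertices are given by s. *)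
Fixpoint spin_integral (l : seq V) (F : (V -> spin R n) -> R)
    (s : V -> spin R n) : R :=
  if l is v :: l' then
    \int[sigma]_(x in @sphere R n) spin_integral l' F [eta s with v |-> x]
  else F s.

(* The factor 1/2 is there because each edge {u, v} occurs in the sum both as
   (u, v) and as (v, u). *)
Definition hamiltonian (B : {fset V}) (s : V -> spin R n) : R :=
  - (2^-1 * \sum_(u <- B) \sum_(v <- B | adj u v) dotp (s u) (s v)).

Definition gibbs_integral (B : {fset V}) (beta : R)
    (F : (V -> spin R n) -> R) : R :=
  spin_integral B (fun s => F s * expR (- beta * hamiltonian B s))
    (fun=> [tuple 0 | _ < n]).

(* The correlation in the ball of radius r, with free boundary conditions. It
   is meaningful once the ball contains u and v, hence for all large r. *)
Definition ball_correlation (o : V) (beta : R) (u v : V) (r : nat) : R :=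
  let B := gball adj o r in
  gibbs_integral B beta (fun s => dotp (s u) (s v)) /
  gibbs_integral B beta (fun=> 1).

(* The absolute value of the pair correlation, which is the limit of
   ball_correlation as r grows. For n >= 3 the existence of that limit is not
   known in general; the limit superior makes sense in all cases, and is the
   absolute value of the limit as soon as the latter exists, see below. *)
Definition abs_pair_correlation (o : V) (beta : R) (u v : V) : \bar R :=
  limn_esup (fun r => `|ball_correlation o beta u v r|%:E).

Lemma abs_pair_correlationE (o : V) (beta : R) (u v : V) (l : R) :
  ball_correlation o beta u v @ \oo --> l ->
  abs_pair_correlation o beta u v = `|l|%:E.
Proof.
move=> cl; have cabs : `|ball_correlation o beta u v r|%:E @[r --> \oo] --> `|l|%:E.
  by apply: cvg_EFin; [exact: nearW | exact: cvg_norm].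
by rewrite /abs_pair_correlation (cvg_limn_einf_sup cabs).
Qed.

End OnModel.

(* Main.v *)
Require Import Defs.
From mathcomp Require Import all_boot all_order all_algebra finmap.
From mathcomp Require Import all_classical all_reals all_analysis measurable_realfun.
From mathcomp Require Import ring lra.

Set Implicit Arguments.
Unset Strict Implicit.
Unset Printing Implicit Defensive.

Import Order.TTheory GRing.Theory Num.Theory.
Import numFieldNormedType.Exports.

(** The McBryan-Spencer complex rotation. Fix two coordinates of the spins, view
   them as a complex number z_x at each vertex x, and let a be a real function on
   the vertices. By invariance of the uniform measure, the integral of an analytic
   function of the spins does not change when every z_x is rotated by the angle
   t * a x with t real, hence neither does it for t imaginary. Applied to
   z_u * conj z_v * exp (-beta H) this bounds the correlation, up to a factor, by
   exp (-(a u - a v) + 2 beta * (sum over the edges of (cosh (a x - a y) - 1))).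

   So a function a is needed whose Dirichlet energy is at most of the order of its
   variation a u - a v, itself of the order of d(u, v); a small multiple of it then
   makes the linear term win. In the half-plane, ln |z - p| cut off at its values
   at u and v is such a function, where the real number p is the abscissa of the
   lower of the two points: its squared gradient is y^2 / |z - p|^2, which in each
   generation of Whitney squares is summable, and there are about as many
   generations as the variation. *)

Local Open Scope classical_set_scope.
Local Open Scope ring_scope.

(** * Observables and iterated spin integrals *)

Section Observables.
Variables (R : realType) (V : choiceType) (n : nat).
Implicit Types (F G : (V -> spin R n) -> R) (s : V -> spin R n).

(** Balls rather than spheres, because the iterated integrals start from the configuration 0;
    orthogonal maps preserve this condition too. *)
Definition in_balls s := forall v, dotp (s v) (s v) <= 1.

(* Joint measurability is expressed by testing against all measurable families
   of configurations, since V -> spin R n carries no sigma-algebra. *)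
Definition observable F :=
  (forall d (T : measurableType d) (g : T -> V -> spin R n),
    (forall v, measurable_fun setT (g ^~ v)) ->
    measurable_fun setT (fun t => F (g t) : measurableTypeR R)) /\
  exists M : R, forall s, in_balls s -> `|F s| <= M.

Lemma observable_cst (c : R) : observable (fun=> c).
Proof.
by split=> [d T g mg|]; [exact: measurable_cst | exists `|c|].
Qed.

Lemma tnth_le1 (x : spin R n) i : dotp x x <= 1 -> `|tnth x i| <= 1.
Proof.
rewrite /dotp (bigD1 i)//= => x1.
have : tnth x i ^+ 2 <= 1.
  apply: le_trans x1; rewrite -expr2 lerDl.
  by apply: sumr_ge0 => j _; rewrite -expr2 sqr_ge0.
by rewrite -real_normK ?num_real// expr_le1.
Qed.

Lemma observable_coord v i : observable (fun s => tnth (s v) i).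
Proof.
split=> [d T g mg|]; last by exists 1 => s sb; exact: tnth_le1 (sb v).
apply: (measurableT_comp (f := fun x : spin R n => tnth x i)) (mg v).
exact: measurable_tnth.
Qed.

Lemma observableD F G : observable F -> observable G ->
  observable (fun s => F s + G s).
Proof.
move=> [mF [M FM]] [mG [N GN]]; split=> [d T g mg|].
  by apply: measurable_funD; [exact: mF|exact: mG].
exists (M + N) => s sb; rewrite (le_trans (ler_normD _ _))// lerD//; [exact: FM|exact: GN].
Qed.

Lemma observableM F G : observable F -> observable G ->
  observable (fun s => F s * G s).
Proof.
move=> [mF [M FM]] [mG [N GN]]; split=> [d T g mg|].
  by apply: measurable_funM; [exact: mF|exact: mG].
by exists (M * N) => s sb; rewrite normrM ler_pM//; [exact: FM|exact: GN].
Qed.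

Lemma observableN F : observable F -> observable (fun s => - F s).
Proof.
move=> oF; rewrite (_ : (fun _ => _) = fun s => -1 * F s).
  exact: observableM (observable_cst _) oF.
by apply/funext => s; rewrite mulN1r.
Qed.

Lemma observable_sum (I : Type) (r : seq I) (P : pred I)
    (F : I -> (V -> spin R n) -> R) :
  (forall i, observable (F i)) -> observable (fun s => \sum_(i <- r | P i) F i s).
Proof.
move=> oF; elim: r => [|i r IH].
  by under eq_fun do rewrite big_nil; exact: observable_cst.
under eq_fun do rewrite big_cons; case: (P i) => //.
exact: observableD.
Qed.

Lemma observable_comp (h : R -> R) F : continuous h ->
    (forall M, exists N, forall x, `|x| <= M -> `|h x| <= N) ->
  observable F -> observable (fun s => h (F s)).
Proof.
move=> ch bh [mF [M FM]]; split=> [d T g mg|].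
  apply: (measurableT_comp (f := h)); last exact: mF.
  exact: continuous_measurable_fun.
by have [N hN] := bh M; exists N => s sb; apply: hN; exact: FM.
Qed.

Lemma observable_expR F : observable F -> observable (fun s => expR (F s)).
Proof.
apply: observable_comp; first exact: continuous_expR.
move=> M; exists (expR M) => x xM.
by rewrite ger0_norm ?expR_ge0// ler_expR (le_trans (ler_norm _)).
Qed.

Lemma observable_cos F : observable F -> observable (fun s => cos (F s)).
Proof.
by apply: observable_comp => [|M]; [exact: continuous_cos|exists 1 => x _; exact: cos_max].
Qed.

Lemma observable_sin F : observable F -> observable (fun s => sin (F s)).
Proof.
by apply: observable_comp => [|M]; [exact: continuous_sin|exists 1 => x _; exact: sin_max].
Qed.

Variable sigma : probability (spin R n) R.

Lemma measurable_dotp : measurable_fun setT (fun x : spin R n => dotp x x : measurableTypeR R).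
Proof.
rewrite /dotp; apply: measurable_sum => i.
by apply: measurable_funM; exact: measurable_tnth.
Qed.

Lemma measurable_sphere : measurable (@sphere R n).
Proof.
rewrite (_ : @sphere R n = setT `&` (fun x : spin R n => dotp x x) @^-1` [set 1]).
  by apply: measurable_dotp => //; exact: measurable_set1.
by rewrite setTI.
Qed.

Lemma in_balls_upd s v x : in_balls s -> sphere x -> in_balls [eta s with v |-> x].
Proof. by move=> sb x1 w /=; case: eqP => // _; rewrite x1. Qed.

Lemma measurable_upd d (T : measurableType d) (g : T -> V -> spin R n) (h : T -> spin R n) v :
  (forall w, measurable_fun setT (g ^~ w)) -> measurable_fun setT h ->
  forall w, measurable_fun setT (fun t => [eta g t with v |-> h t] w).
Proof. by move=> mg mh w /=; case: eqP => // _. Qed.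

Lemma observable_upd F s v : observable F ->
  measurable_fun setT (fun x => F [eta s with v |-> x] : measurableTypeR R).
Proof.
move=> [mF _]; apply: mF => w.
apply: (measurable_upd (g := fun=> s) (h := id)) => // u; exact: measurable_cst.
Qed.

Hypothesis sigma1 : sigma (@sphere R n) = 1%E.

Lemma Rintegral_sphere_cst (c : R) : \int[sigma]_(x in @sphere R n) c = c.
Proof.
have -> : \int[sigma]_(x in @sphere R n) c = c * fine (sigma (@sphere R n)).
  exact: Rintegral_cst measurable_sphere c.
by rewrite sigma1 /= mulr1.
Qed.

Lemma observable_integrable F s v : observable F -> in_balls s ->
  sigma.-integrable (@sphere R n) (EFin \o (fun x => F [eta s with v |-> x])).
Proof.
move=> oF sb; have [M FM] := oF.2.
apply: (le_integrable measurable_sphere (g := EFin \o cst M)).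
- by apply/measurable_EFinP; apply: measurable_funTS; exact: observable_upd.
- move=> x x1 /=; rewrite lee_fin (le_trans _ (ler_norm _))//.
  by apply: FM; exact: in_balls_upd.
- exact: finite_measure_integrable_cst measurable_sphere.
Qed.

Let avg v F s := \int[sigma]_(x in @sphere R n) F [eta s with v |-> x].

(** This closure property keeps every stage of [spin_integral] integrable. The bound passes to the
    average since [sigma] has mass 1 on the sphere; measurability in the parameters is Tonelli's
    theorem for the positive and negative parts. *)
Lemma observable_avg v F : observable F -> observable (avg v F).
Proof.
move=> oF; have [mF [M FM]] := oF; split=> [d T g mg|]; last first.
  exists M => s sb; rewrite /avg.
  apply: (le_trans (le_normr_Rintegral measurable_sphere (observable_integrable v oF sb))).
  have -> : M = \int[sigma]_(x in @sphere R n) M.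
    by rewrite Rintegral_sphere_cst.
  apply: le_Rintegral measurable_sphere _ _ _.
  - have := observable_integrable v oF sb; move=> /integrable_norm.
    by apply: eq_integrable => //; exact: measurable_sphere.
  - exact: finite_measure_integrable_cst measurable_sphere.
  - by move=> x x1; apply: FM; exact: in_balls_upd.
(* Extended by 0 off the sphere, the integrand becomes a jointly measurable function of the
   parameter and the spin at [v]. *)
pose f (z : T * spin R n) : R :=
  ((fun x => F [eta g z.1 with v |-> x]) \_ (@sphere R n)) z.2.
have mf : measurable_fun setT (EFin \o f).
  apply/measurable_EFinP.
  rewrite /f /patch; apply: measurable_fun_if => //.
  - apply: (measurable_fun_bool true).
    rewrite (_ : _ @^-1` _ = setT `*` @sphere R n); last first.
      apply/seteqP; split=> -[t x] /=; first by move=> /set_mem.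
      by move=> [_ x1]; apply/mem_set.
    by rewrite setTI; apply: measurableX => //; exact: measurable_sphere.
  - apply: measurable_funTS.
    apply: (mF _ _ (fun z : T * spin R n => [eta g z.1 with v |-> z.2])).
    apply: (measurable_upd (g := fun z => g z.1) (h := snd)) => [w|].
      exact: (measurableT_comp (mg w)).
    exact: measurable_snd.
rewrite (_ : (fun t => _) = fun t =>
   fine (\int[sigma]_x (EFin \o f)^\+%E (t, x) -
         \int[sigma]_x (EFin \o f)^\-%E (t, x))); last first.
  apply/funext => t; rewrite /avg Rintegral_mkcond /Rintegral integralE.
  by congr (fine (_ - _)); apply: eq_integral => x _; rewrite ?funeposE ?funenegE.
apply: (measurableT_comp (f := @fine R : \bar R -> measurableTypeR R)).
  exact: fine_measurable.
apply: emeasurable_funB.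
- exact: (@measurable_fun_fubini_tonelli_F _ _ T _ _ sigma (EFin \o f)^\+%E
    (measurable_funepos mf) (funepos_ge0 _)).
- exact: (@measurable_fun_fubini_tonelli_F _ _ T _ _ sigma (EFin \o f)^\-%E
    (measurable_funeneg mf) (funeneg_ge0 _)).
Qed.

Local Notation SI := (spin_integral sigma).

Lemma observable_spin_integral l F : observable F -> observable (SI l F).
Proof.
elim: l F => [//|v l IH] F oF /=.
exact: (observable_avg v (IH _ oF)).
Qed.

Lemma le_spin_integral l F G s : observable F -> observable G ->
  (forall s', in_balls s' -> F s' <= G s') -> in_balls s -> SI l F s <= SI l G s.
Proof.
move=> oF oG FG; elim: l s => [s|v l IH s] sb /=; first exact: FG.
apply: (le_Rintegral measurable_sphere).
- exact: (observable_integrable v (observable_spin_integral l oF) sb).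
- exact: (observable_integrable v (observable_spin_integral l oG) sb).
- by move=> x x1; apply: IH; exact: in_balls_upd.
Qed.

Lemma spin_integralD l F G s : observable F -> observable G -> in_balls s ->
  SI l (fun s => F s + G s) s = SI l F s + SI l G s.
Proof.
move=> oF oG; elim: l s => [//|v l IH] s sb /=.
rewrite -(RintegralD measurable_sphere).
- by apply: eq_Rintegral => x /set_mem x1; apply: IH; exact: in_balls_upd.
- exact: (observable_integrable v (observable_spin_integral l oF) sb).
- exact: (observable_integrable v (observable_spin_integral l oG) sb).
Qed.

Lemma spin_integralZ l c F s : observable F -> in_balls s ->
  SI l (fun s => c * F s) s = c * SI l F s.
Proof.
move=> oF; elim: l s => [//|v l IH] s sb /=.
rewrite -(RintegralZl _ measurable_sphere).
- by apply: eq_Rintegral => x /set_mem x1; apply: IH; exact: in_balls_upd.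
- exact: (observable_integrable v (observable_spin_integral l oF) sb).
Qed.

Lemma spin_integralN l F s : observable F -> in_balls s ->
  SI l (fun s => - F s) s = - SI l F s.
Proof.
move=> oF sb; rewrite -mulN1r -spin_integralZ//.
by congr (SI l _ s); apply/funext => ?; rewrite mulN1r.
Qed.

Lemma spin_integral_cst l c s : SI l (fun=> c) s = c.
Proof.
elim: l s => [//|v l IH] s /=.
by under eq_Rintegral do rewrite IH; exact: Rintegral_sphere_cst.
Qed.

Lemma spin_integral_sum (I : Type) (r : seq I) l (F : I -> (V -> spin R n) -> R) s :
  (forall i, observable (F i)) -> in_balls s ->
  SI l (fun s => \sum_(i <- r) F i s) s = \sum_(i <- r) SI l (F i) s.
Proof.
move=> oF sb; elim: r => [|i r IH].
  rewrite big_nil -[RHS](spin_integral_cst l 0 s).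
  by congr (SI l _ s); apply/funext => ?; rewrite big_nil.
rewrite big_cons -IH -spin_integralD//; last exact: observable_sum.
by congr (SI l _ s); apply/funext => ?; rewrite big_cons.
Qed.

Lemma spin_integral_norm_le l F G s : observable F -> observable G ->
  (forall s', in_balls s' -> `|F s'| <= G s') -> in_balls s ->
  `|SI l F s| <= SI l G s.
Proof.
move=> oF oG FG sb; rewrite ler_norml -spin_integralN//; apply/andP; split.
  apply: le_spin_integral => //; first exact: observableN.
  by move=> s' /FG; rewrite ler_norml => /andP[].
by apply: le_spin_integral => // s' /FG; rewrite ler_norml => /andP[].
Qed.

Definition orthogonal_mx (A : 'M[R]_n) := A *m A^T = 1%:M.

Lemma dotp_mxapp A x y : orthogonal_mx A -> dotp (mxapp A x) (mxapp A y) = dotp x y.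
Proof.
move=> /mulmx1C AA; rewrite /dotp.
transitivity (\sum_i \sum_j \sum_k (A i j * A i k) * (tnth x j * tnth y k)).
  apply: eq_bigr => i _; rewrite !tnth_mktuple mulr_suml.
  apply: eq_bigr => j _; rewrite mulr_sumr; apply: eq_bigr => k _; ring.
rewrite exchange_big; apply: eq_bigr => j _; rewrite exchange_big /=.
transitivity (\sum_k (A^T *m A) j k * (tnth x j * tnth y k)).
  apply: eq_bigr => k _; rewrite mxE mulr_suml; apply: eq_bigr => i _.
  by rewrite mxE.
rewrite AA (bigD1 j)//= mxE eqxx mul1r big1 ?addr0// => k kj.
by rewrite mxE eq_sym (negbTE kj) mul0r.
Qed.

Lemma measurable_mxapp A : measurable_fun setT (mxapp A : spin R n -> spin R n).
Proof.
apply/measurable_fun_tnthP => i.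
rewrite (_ : _ \o _ = fun s : spin R n => \sum_(j < n) A i j * tnth s j); last first.
  by apply/funext => s /=; rewrite tnth_mktuple.
apply: measurable_sum => j; apply: measurable_funM; first exact: measurable_cst.
exact: measurable_tnth.
Qed.

Hypothesis sigmaO : forall A, orthogonal_mx A ->
  forall B : set (spin R n), measurable B -> sigma (mxapp A @^-1` B) = sigma B.

(** The sphere is its own preimage under [A], and [sigma] its own image, so this is a change of
    variables. *)
Lemma Rintegral_mxapp A (f : spin R n -> R) : orthogonal_mx A ->
  measurable_fun setT f ->
  sigma.-integrable (@sphere R n) (EFin \o (f \o mxapp A)) ->
  \int[sigma]_(x in @sphere R n) f (mxapp A x) = \int[sigma]_(x in @sphere R n) f x.
Proof.
move=> OA mf intf.
have pre : mxapp A @^-1` @sphere R n = @sphere R n.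
  by apply/seteqP; split => x; rewrite /sphere /= dotp_mxapp.
rewrite /Rintegral; congr fine.
transitivity (\int[pushforward sigma (mxapp A)]_(x in @sphere R n) (EFin \o f) x)%E.
  have mEf : measurable_fun setT (EFin \o f) by exact/measurable_EFinP.
  rewrite (integral_pushforward (measurable_mxapp A) mEf _ measurable_sphere) ?pre//.
apply: eq_measure_integral; first exact: measurable_mxapp.
by move=> mA B mB _; exact: sigmaO. 
Qed.

Definition act (A : V -> 'M[R]_n) s : V -> spin R n := fun v => mxapp (A v) (s v).

Lemma observable_act A F : (forall v, orthogonal_mx (A v)) ->
  observable F -> observable (fun s => F (act A s)).
Proof.
move=> OA [mF [M FM]]; split=> [d T g mg|].
  apply: (mF _ _ (fun t => act A (g t))) => v.
  exact: (measurableT_comp (measurable_mxapp (A v)) (mg v)).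
by exists M => s sb; apply: FM => v; rewrite dotp_mxapp.
Qed.

(** The spins are integrated one at a time, so each vertex may have its own rotation. The spins
    outside [l] are not integrated, which is why [act A s] remains on the right. *)
Lemma spin_integral_act l A F s : (forall v, orthogonal_mx (A v)) ->
  observable F -> in_balls s ->
  SI l (fun s => F (act A s)) s = SI l F (act A s).
Proof.
move=> OA oF; elim: l s => [//|v l IH] s sb /=.
have actb s' : in_balls s' -> in_balls (act A s').
  by move=> s'b w; rewrite dotp_mxapp.
have actE x : act A [eta s with v |-> x] = [eta act A s with v |-> mxapp (A v) x].
  by apply/funext => w; rewrite /act /=; case: eqP => // ->.
transitivity (\int[sigma]_(x in @sphere R n) SI l F [eta act A s with v |-> mxapp (A v) x]).
  apply: eq_Rintegral => x /set_mem x1; rewrite IH ?actE//; exact: in_balls_upd.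
have oSF := observable_spin_integral l oF.
apply: (Rintegral_mxapp (f := fun x => SI l F [eta act A s with v |-> x])) => //.
  exact: observable_upd.
have := observable_integrable v (observable_act OA oSF) sb.
by under eq_fun do rewrite actE.
Qed.

End Observables.

(** * First-order expansions with a quadratic error *)

Section ElementaryBounds.
Variable R : realType.
Implicit Types x y z : R.

(** The inequality 1 + z <= exp z, used at z and at -z, places the remainder between 0 and z * (exp
    z - 1). *)
Lemma expR_taylor1 z : `|expR z - 1 - z| <= expR `|z| * z ^+ 2.
Proof.
have e0 := expR_ge1Dx z.
rewrite ger0_norm; last by lra.
have e1 : expR z - 1 <= z * expR z.
  have := expR_ge1Dx (- z); rewrite expRN => h.
  have ep := expR_gt0 z.
  have : (1 - z) * expR z <= 1 by rewrite -ler_pdivlMr// div1r.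
  lra.
have [z0|z0] := leP 0 z.
  by have := ler_wpM2l z0 e1; rewrite ger0_norm//; nra.
have : 1 <= expR `|z| by rewrite -expR0 ler_expR.
nra.
Qed.

Lemma sin_le z : `|sin z| <= `|z|.
Proof.
wlog z0 : z / 0 <= z => [hw|].
  have [|/ltW z0] := leP 0 z; first exact: hw.
  by rewrite -normrN -sinN -(normrN z); apply: hw; rewrite oppr_ge0.
have [c _] := @MVT_segment R sin cos 0 z z0 (fun x _ => is_derive_sin x)
  (continuous_subspaceT (@continuous_sin R)).
rewrite sin0 !subr0 => ->.
by rewrite normrM ler_piMl// cos_max.
Qed.

Lemma cos_taylor1 z : `|cos z - 1| <= z ^+ 2.
Proof.
have -> : cos z - 1 = - 2 * sin (z / 2) ^+ 2.
  have {1}-> : z = (z / 2) *+ 2 by rewrite -mulr_natr divfK// pnatr_eq0.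
  by rewrite cos_mulr2n cos2sin2; ring.
have := sin_le (z / 2); rewrite -ler_sqr ?nnegrE// !real_normK ?num_real// => h.
rewrite normrM normrN !ger0_norm ?sqr_ge0//.
by have := sqr_ge0 z; nra.
Qed.

Lemma sin_taylor1 z : `|sin z - z| <= z ^+ 2.
Proof.
wlog z0 : z / 0 <= z => [hw|].
  have [|/ltW z0] := leP 0 z; first exact: hw.
  have := hw (- z); rewrite oppr_ge0 sqrrN sinN => /(_ z0).
  by rewrite -opprD normrN.
have [c] := @MVT_segment R sin cos 0 z z0 (fun x _ => is_derive_sin x)
  (continuous_subspaceT (@continuous_sin R)).
rewrite sin0 !subr0 in_itv/= => /andP[c0 cz] ->.
have -> : cos c * z - z = (cos c - 1) * z by ring.
have -> : cos c - 1 = - 2 * sin (c / 2) ^+ 2.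
  have {1}-> : c = (c / 2) *+ 2 by rewrite -mulr_natr divfK// pnatr_eq0.
  by rewrite cos_mulr2n cos2sin2; ring.
have h : `|sin (c / 2)| <= c / 2.
  by apply: (le_trans (sin_le _)); rewrite ger0_norm// divr_ge0.
have h1 := sin_max (c / 2).
rewrite !normrM normrN (ger0_norm z0) (ger0_norm (ler0n _ 2)) expr2.
have s0 := normr_ge0 (sin (c / 2)).
by rewrite ler_wpM2r//; nra.
Qed.

(** In N equal steps from 0 to 1 the function changes by at most M / N in total, for every N. This
    takes the place of differentiating under the integral sign. *)
Lemma eq_of_quadratic_increments (Phi : R -> R) M :
  (forall t h, 0 <= t <= 1 -> 0 <= h <= 1 -> `|Phi (t + h) - Phi t| <= M * h ^+ 2) ->
  Phi 1 = Phi 0.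
Proof.
move=> Phi_incr.
have step N k : (k <= N.+1)%N ->
    `|Phi (k%:R / N.+1%:R) - Phi 0| <= k%:R * (M * (N.+1%:R^-1) ^+ 2).
  have N0 : 0 < N.+1%:R :> R by rewrite ltr0n.
  elim: k => [_|k IH kN]; first by rewrite !mul0r subrr normr0.
  rewrite -natr1 !mulrDl !mul1r.
  rewrite -(subrKA (Phi (k%:R / N.+1%:R))) (le_trans (ler_normD _ _))//.
  rewrite addrC lerD//; first exact: IH (ltnW kN).
  apply: Phi_incr.
    by rewrite divr_ge0//= ler_pdivrMr// mul1r ler_nat ltnW.
  by rewrite invr_ge0 ler0n/= invf_le1// ler1n.
have M0 : 0 <= M.
  have := Phi_incr 0 1; rewrite !lexx ler01 expr1n mulr1 => /(_ isT isT).
  exact: le_trans.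
apply/eqP; rewrite -subr_eq0 -normr_le0 leNgt; apply/negP => d0.
set e := `|_| in d0.
(* With this many steps the total change M / (N + 1) is below [e]. *)
pose N := Num.truncn (M / e).
have : M / e < N.+1%:R by rewrite truncnS_gt.
have N0 : 0 < N.+1%:R :> R by rewrite ltr0n.
have := step N N.+1 (leqnn _); rewrite divff ?gt_eqF// -/e.
have -> : N.+1%:R * (M * N.+1%:R^-1 ^+ 2) = M / N.+1%:R :> R.
  by field; rewrite gt_eqF.
rewrite ler_pdivlMr// ltr_pdivrMr// => h1 h2.
by have := le_lt_trans h1 h2; rewrite mulrC ltxx.
Qed.

End ElementaryBounds.

(** * Calculus of first-order jets with uniform remainders *)

Section Jets.
Variables (R : realType) (I : Type) (D : I -> Prop).

(* f h = f0 + h f1 + O(h ^ 2), uniformly over D *)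
Definition jet (f : R -> I -> R) (f0 f1 : I -> R) :=
  exists2 M, 0 <= M & forall i, D i -> [/\ `|f0 i| <= M, `|f1 i| <= M
    & forall h, 0 <= h <= 1 -> `|f h i - f0 i - h * f1 i| <= M * h ^+ 2].

Lemma jet_ext f f0 f1 g g0 g1 :
  jet f f0 f1 -> (forall h i, D i -> f h i = g h i) ->
  (forall i, D i -> f0 i = g0 i) -> (forall i, D i -> f1 i = g1 i) -> jet g g0 g1.
Proof.
move=> [M M0 Mf] fg fg0 fg1; exists M => // i Di; have [b0 b1 bf] := Mf _ Di.
by split; rewrite -?fg0 -?fg1// => h hh; rewrite -fg//; exact: bf.
Qed.

Lemma jet_cst (f0 : I -> R) (M : R) : (forall i, D i -> `|f0 i| <= M) ->
  jet (fun=> f0) f0 (fun=> 0).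
Proof.
move=> f0M; exists (Num.max 0 M); first by rewrite le_max lexx.
move=> i Di; rewrite normr0 !le_max lexx f0M ?orbT//; split=> // h _.
by rewrite subrr mulr0 subrr normr0 mulr_ge0 ?sqr_ge0// le_max lexx.
Qed.

Lemma jet_const (c : R) : jet (fun=> fun=> c) (fun=> c) (fun=> 0).
Proof. exact: (jet_cst (M := `|c|)). Qed.

Lemma jet_linear (f0 f1 : I -> R) (M : R) : (forall i, D i -> `|f0 i| <= M /\ `|f1 i| <= M) ->
  jet (fun h i => f0 i + h * f1 i) f0 f1.
Proof.
move=> fM; exists (Num.max 0 M); first by rewrite le_max lexx.
move=> i Di; have [b0 b1] := fM _ Di.
rewrite !le_max b0 b1 !orbT; split=> // h _.
rewrite (_ : _ - _ - _ = 0); last by ring.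
by rewrite normr0 mulr_ge0 ?sqr_ge0// le_max lexx.
Qed.

Lemma jetD f f0 f1 g g0 g1 : jet f f0 f1 -> jet g g0 g1 ->
  jet (fun h i => f h i + g h i) (fun i => f0 i + g0 i) (fun i => f1 i + g1 i).
Proof.
move=> [M M0 Mf] [N N0 Ng]; exists (M + N); first exact: addr_ge0.
move=> i Di; have [? ? bf] := Mf _ Di; have [? ? bg] := Ng _ Di.
split; [by rewrite (le_trans (ler_normD _ _))// lerD..|move=> h hh].
rewrite (_ : _ - _ - _ = (f h i - f0 i - h * f1 i) + (g h i - g0 i - h * g1 i)); last by ring.
by rewrite mulrDl (le_trans (ler_normD _ _))// lerD// ?bf ?bg.
Qed.

Lemma jetM f f0 f1 g g0 g1 : jet f f0 f1 -> jet g g0 g1 ->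
  jet (fun h i => f h i * g h i) (fun i => f0 i * g0 i)
      (fun i => f1 i * g0 i + f0 i * g1 i).
Proof.
move=> [M M0 Mf] [N N0 Ng].
(* 6 = 3 + 2 + 1, the constants of [t1], [t2] and [t3] below. *)
exists (6 * (M * N)); first by rewrite !mulr_ge0.
move=> i Di; have [f0M f1M bf] := Mf _ Di; have [g0N g1N bg] := Ng _ Di.
have MN0 : 0 <= M * N by rewrite mulr_ge0.
have nM (x y A B : R) : 0 <= A -> 0 <= B -> `|x| <= A -> `|y| <= B -> `|x * y| <= A * B.
  by move=> A0 B0 xA yB; rewrite normrM ler_pM.
split.
- by have := nM _ _ _ _ M0 N0 f0M g0N; lra.
- rewrite (le_trans (ler_normD _ _))//.
  by have := nM _ _ _ _ M0 N0 f1M g0N; have := nM _ _ _ _ M0 N0 f0M g1N; lra.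
move=> h /[dup] hh /andP[h0 h1].
set ef := f h i - f0 i - h * f1 i; set eg := g h i - g0 i - h * g1 i.
have efM : `|ef| <= M * h ^+ 2 by exact: bf.
have egN : `|eg| <= N * h ^+ 2 by exact: bg.
have h2 : h ^+ 2 <= 1 by rewrite expr_le1.
have h20 := sqr_ge0 h.
rewrite (_ : _ - _ - _ = ef * (g0 i + h * g1 i + eg) + (f0 i + h * f1 i) * eg
    + h ^+ 2 * (f1 i * g1 i)); last by rewrite /ef /eg; ring.
have hb (x : R) (A : R) : `|x| <= A -> `|h * x| <= A.
  by move=> xA; rewrite normrM ger0_norm// (le_trans _ xA)// ler_piMl.
have b1 : `|g0 i + h * g1 i + eg| <= 3 * N.
  rewrite (le_trans (ler_normD _ _))//.
  have := ler_normD (g0 i) (h * g1 i); have := hb _ _ g1N.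
  have : N * h ^+ 2 <= N by rewrite ler_piMr.
  lra.
have b2 : `|f0 i + h * f1 i| <= 2 * M.
  have := ler_normD (f0 i) (h * f1 i); have := hb _ _ f1M; lra.
have t1 : `|ef * (g0 i + h * g1 i + eg)| <= (M * h ^+ 2) * (3 * N).
  by apply: nM => //; rewrite mulr_ge0.
have t2 : `|(f0 i + h * f1 i) * eg| <= (2 * M) * (N * h ^+ 2).
  by apply: nM => //; rewrite mulr_ge0.
have t3 : `|h ^+ 2 * (f1 i * g1 i)| <= h ^+ 2 * (M * N).
  by apply: (nM _ _ _ _ h20 MN0); [rewrite ger0_norm|exact: nM].
rewrite (le_trans (ler_normD _ _))//; apply: (le_trans (lerD (ler_normD _ _) t3)).
apply: (le_trans (lerD (lerD t1 t2) (lexx _))).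
by rewrite le_eqVlt; apply/orP; left; apply/eqP; ring.
Qed.

Lemma jet_sum (J : Type) (r : seq J) (P : pred J) f f0 f1 :
  (forall j, jet (f j) (f0 j) (f1 j)) ->
  jet (fun h i => \sum_(j <- r | P j) f j h i) (fun i => \sum_(j <- r | P j) f0 j i)
      (fun i => \sum_(j <- r | P j) f1 j i).
Proof.
move=> jf; elim: r => [|j r IH].
  apply: (jet_ext (f := fun _ _ => 0) (f0 := fun=> 0) (f1 := fun=> 0)).
  - by apply: (jet_cst (M := 0)) => i _; rewrite normr0.
  - by move=> *; rewrite big_nil.
  - by move=> *; rewrite big_nil.
  - by move=> *; rewrite big_nil.
case Pj : (P j).
  by apply: (jet_ext (jetD (jf j) IH)) => *; rewrite big_cons Pj.
by apply: (jet_ext IH) => *; rewrite big_cons Pj.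
Qed.

(** The Taylor bound on [phi] is asked on bounded sets only, so that the exponential qualifies. *)
Lemma jet_comp (phi dphi : R -> R) f f0 f1 :
  (forall M, exists2 N, 0 <= N & forall x y, `|x| <= M -> `|y| <= M ->
     [/\ `|phi x| <= N, `|dphi x| <= N
       & `|phi y - phi x - (y - x) * dphi x| <= N * (y - x) ^+ 2]) ->
  jet f f0 f1 ->
  jet (fun h i => phi (f h i)) (fun i => phi (f0 i)) (fun i => dphi (f0 i) * f1 i).
Proof.
move=> phiP [M M0 Mf].
(* For h in [0, 1], [f h] stays within 2 * M of [f0], hence within 3 * M of 0. *)
have [N N0 HN] := phiP (3 * M).
exists (N + N * M + N * (2 * M) ^+ 2); first by rewrite !addr_ge0 ?mulr_ge0 ?sqr_ge0.
have NM0 : 0 <= N * M by rewrite mulr_ge0.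
have NM1 : 0 <= N * (2 * M) ^+ 2 by rewrite mulr_ge0 ?sqr_ge0.
move=> i Di; have [f0M f1M bf] := Mf _ Di.
have f03 : `|f0 i| <= 3 * M by lra.
have [p0 p1 _] := HN _ _ f03 f03.
split; first by lra.
  have : `|dphi (f0 i) * f1 i| <= N * M by rewrite normrM ler_pM.
  lra.
move=> h /[dup] hh /andP[h0 h1].
have e := bf _ hh; set ef := _ - _ - _ in e.
have h2 : h ^+ 2 <= h by rewrite expr2 ler_piMr.
have d : `|f h i - f0 i| <= 2 * M * h.
  rewrite (_ : _ - _ = ef + h * f1 i); last by rewrite /ef; ring.
  rewrite (le_trans (ler_normD _ _))// normrM (ger0_norm h0).
  have : h * `|f1 i| <= h * M by rewrite ler_wpM2l.
  have : M * h ^+ 2 <= M * h by rewrite ler_wpM2l.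
  lra.
have fh3 : `|f h i| <= 3 * M.
  rewrite (_ : f h i = (f h i - f0 i) + f0 i); last by ring.
  rewrite (le_trans (ler_normD _ _))//.
  have : 2 * M * h <= 2 * M * 1 by rewrite ler_wpM2l// mulr_ge0.
  lra.
have [_ _ t] := HN _ _ f03 fh3.
rewrite (_ : _ - _ - _ = (phi (f h i) - phi (f0 i) - (f h i - f0 i) * dphi (f0 i))
   + ef * dphi (f0 i)); last by rewrite /ef; ring.
rewrite (le_trans (ler_normD _ _))//.
have t1 : `|ef * dphi (f0 i)| <= M * h ^+ 2 * N by rewrite normrM ler_pM.
have t2 : (f h i - f0 i) ^+ 2 <= (2 * M * h) ^+ 2.
  by rewrite -real_normK ?num_real// ler_sqr ?nnegrE// !mulr_ge0.
have t3 : N * (f h i - f0 i) ^+ 2 <= N * (2 * M * h) ^+ 2 by rewrite ler_wpM2l.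
have : N * (2 * M * h) ^+ 2 = N * (2 * M) ^+ 2 * h ^+ 2 by ring.
have := mulr_ge0 N0 (sqr_ge0 h).
lra.
Qed.

Lemma jet_expR f f0 f1 : jet f f0 f1 ->
  jet (fun h i => expR (f h i)) (fun i => expR (f0 i)) (fun i => expR (f0 i) * f1 i).
Proof.
apply: jet_comp => M; exists (expR M * (1 + expR (2 * M))).
  by rewrite mulr_ge0 ?expR_ge0// addr_ge0 ?expR_ge0.
move=> x y xM yM.
have eM : expR x <= expR M by rewrite ler_expR (le_trans (ler_norm _)).
have e2 := expR_ge0 (2 * M); have e3 := expR_ge0 x.
have e1 : `|expR x| <= expR M * (1 + expR (2 * M)) by rewrite ger0_norm//; nra.
split=> //.
have -> : expR y - expR x - (y - x) * expR x = expR x * (expR (y - x) - 1 - (y - x)).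
  rewrite !mulrBr -expRD (_ : x + (y - x) = y); [ring|ring].
have yx : `|y - x| <= 2 * M by rewrite (le_trans (ler_normB _ _))//; lra.
have t := expR_taylor1 (y - x).
have t1 : expR `|y - x| <= 1 + expR (2 * M) by rewrite ler_wpDl// ler_expR.
by rewrite normrM (ger0_norm e3) -mulrA ler_pM// (le_trans t)// ler_wpM2r// sqr_ge0.
Qed.

Let trig_remainder (a b z c1 s1 : R) : `|a| <= 1 -> `|b| <= 1 ->
  `|c1| <= z ^+ 2 -> `|s1| <= z ^+ 2 -> `|a * c1 + b * s1| <= 2 * z ^+ 2.
Proof.
move=> a1 b1 c1z s1z; rewrite (le_trans (ler_normD _ _))// !normrM.
have t1 : `|a| * `|c1| <= 1 * z ^+ 2 by rewrite ler_pM.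
have t2 : `|b| * `|s1| <= 1 * z ^+ 2 by rewrite ler_pM.
lra.
Qed.

Lemma jet_cos f f0 f1 : jet f f0 f1 ->
  jet (fun h i => cos (f h i)) (fun i => cos (f0 i)) (fun i => - sin (f0 i) * f1 i).
Proof.
apply: (jet_comp (dphi := fun x => - sin x)) => M; exists 2 => // x y _ _.
have := cos_max x; have := sin_max x => sx cx.
split; [lra|rewrite normrN; lra|].
rewrite (_ : _ - _ - _ = cos x * (cos (y - x) - 1) + (- sin x) * (sin (y - x) - (y - x))).
  by apply: trig_remainder; rewrite ?normrN ?cos_taylor1 ?sin_taylor1.
rewrite {1}(_ : y = x + (y - x)); last by ring.
by rewrite cosD; ring.
Qed.

Lemma jet_sin f f0 f1 : jet f f0 f1 ->
  jet (fun h i => sin (f h i)) (fun i => sin (f0 i)) (fun i => cos (f0 i) * f1 i).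
Proof.
apply: jet_comp => M; exists 2 => // x y _ _.
have := cos_max x; have := sin_max x => sx cx.
split; [lra|lra|].
rewrite (_ : _ - _ - _ = sin x * (cos (y - x) - 1) + cos x * (sin (y - x) - (y - x))).
  by apply: trig_remainder; rewrite ?cos_taylor1 ?sin_taylor1.
rewrite {1}(_ : y = x + (y - x)); last by ring.
by rewrite sinD; ring.
Qed.

End Jets.

(** * Complex rotation of the spins *)

Section PlaneRotation.
Variables (R : realType) (n : nat) (i j : 'I_n).
Hypothesis ij : i != j.
Implicit Types (x y : spin R n) (t : R).

Definition rot_mx t : 'M[R]_n := \matrix_(k, l)
  if k == i then cos t * (l == i)%:R - sin t * (l == j)%:R
  else if k == j then sin t * (l == i)%:R + cos t * (l == j)%:R
  else (l == k)%:R.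

Lemma sum_rot_mx t k (b : 'I_n -> R) : \sum_l rot_mx t k l * b l =
  if k == i then cos t * b i - sin t * b j
  else if k == j then sin t * b i + cos t * b j else b k.
Proof.
have sel m : \sum_l (l == m)%:R * b l = b m.
  rewrite (bigD1 m)//= eqxx mul1r big1 ?addr0// => l lm.
  by rewrite (negbTE lm) mul0r.
under eq_bigr do rewrite mxE.
case: ifP => _.
  under eq_bigr do rewrite mulrBl -!mulrA.
  by rewrite sumrB -!mulr_sumr !sel.
case: ifP => _ //.
under eq_bigr do rewrite mulrDl -!mulrA.
by rewrite big_split /= -!mulr_sumr !sel.
Qed.

Lemma orthogonal_rot_mx t : orthogonal_mx (rot_mx t).
Proof.
apply/matrixP => k m; rewrite mxE.
under eq_bigr do rewrite [rot_mx t]lock mxE -lock.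
rewrite (sum_rot_mx t k (fun l => rot_mx t m l)) !mxE.
have ji : (j == i) = false by rewrite eq_sym (negbTE ij).
have h := cos2Dsin2 t.
rewrite !eqxx (negbTE ij) ji.
have [->|ki] := eqVneq k i.
  have [mi|mi] := eqVneq m i; first by rewrite /=; nra.
  have [mj|mj] := eqVneq m j; first by rewrite ?mj ?(negbTE ij) /=; ring.
  by rewrite /=; ring.
have [->|kj] := eqVneq k j.
  have [mi|mi] := eqVneq m i; first by rewrite ?mi ?ji /=; ring.
  have [mj|mj] := eqVneq m j; first by rewrite /=; nra.
  by rewrite /=; ring.
have [mi|mi] := eqVneq m i; first by rewrite ?mi ?(negbTE ki) /=; ring.
have [mj|mj] := eqVneq m j; first by rewrite ?mj ?(negbTE kj) /=; ring.
by rewrite eq_sym.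
Qed.

Lemma tnth_rot t x k : tnth (mxapp (rot_mx t) x) k =
  if k == i then cos t * tnth x i - sin t * tnth x j
  else if k == j then sin t * tnth x i + cos t * tnth x j else tnth x k.
Proof. by rewrite tnth_mktuple (sum_rot_mx t k (fun l => tnth x l)). Qed.

(* The real and imaginary parts of z * conj w, where z, w are the projections
   of x, y to the plane (i, j), viewed as the complex plane. *)
Definition plane_re x y := tnth x i * tnth y i + tnth x j * tnth y j.
Definition plane_im x y := tnth x j * tnth y i - tnth x i * tnth y j.

Lemma plane_re_rot s t x y : plane_re (mxapp (rot_mx s) x) (mxapp (rot_mx t) y) =
  plane_re x y * cos (s - t) - plane_im x y * sin (s - t).
Proof.
rewrite /plane_re /plane_im !tnth_rot !eqxx eq_sym (negbTE ij) cosB sinB; ring.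
Qed.

Lemma plane_im_rot s t x y : plane_im (mxapp (rot_mx s) x) (mxapp (rot_mx t) y) =
  plane_im x y * cos (s - t) + plane_re x y * sin (s - t).
Proof.
rewrite /plane_re /plane_im !tnth_rot !eqxx eq_sym (negbTE ij) cosB sinB; ring.
Qed.

Definition off_plane x y := dotp x y - plane_re x y.

Lemma off_plane_rot s t x y :
  off_plane (mxapp (rot_mx s) x) (mxapp (rot_mx t) y) = off_plane x y.
Proof.
have offE x' y' : off_plane x' y' = \sum_(k < n | (k != i) && (k != j)) tnth x' k * tnth y' k.
  rewrite /off_plane /plane_re /dotp (bigD1 i)//= (bigD1 j)/=; last by rewrite eq_sym.
  by ring.
rewrite !offE; apply: eq_bigr => k /andP[ki kj].
by rewrite !tnth_rot (negbTE ki) (negbTE kj).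
Qed.

Lemma plane_re_bound x y : dotp x x <= 1 -> dotp y y <= 1 -> `|plane_re x y| <= 2.
Proof.
move=> x1 y1; have m k l : `|tnth x k * tnth y l| <= 1.
  by rewrite normrM mulr_ile1 ?tnth_le1.
by rewrite (le_trans (ler_normD _ _))//; have := m i i; have := m j j; lra.
Qed.

Lemma plane_im_bound x y : dotp x x <= 1 -> dotp y y <= 1 -> `|plane_im x y| <= 2.
Proof.
move=> x1 y1; have m k l : `|tnth x k * tnth y l| <= 1.
  by rewrite normrM mulr_ile1 ?tnth_le1.
by rewrite (le_trans (ler_normB _ _))//; have := m i j; have := m j i; lra.
Qed.

End PlaneRotation.

(** * The McBryan-Spencer bound in one coordinate plane *)

Section McBryanSpencer.
Variables (R : realType) (V : choiceType) (adj : rel V) (n : nat) (i j : 'I_n).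
Hypothesis ij : i != j.
Variable sigma : probability (spin R n) R.
Hypothesis sigma_unif : uniform_on_sphere sigma.
Variables (B : {fset V}) (beta : R) (a : V -> R) (u v : V).
Implicit Types (s : V -> spin R n) (t h : R) (x y : V).

Local Notation re := (plane_re i j).
Local Notation im := (plane_im i j).
Local Notation off := (off_plane i j).

(** Hyperbolic cosine and sine: cos (I * t) = [ch t] and sin (I * t) = I * [sh t]. *)
Definition ch t := (expR t + expR (- t)) / 2.
Definition sh t := (expR t - expR (- t)) / 2.

Let dl x y := a x - a y.

Let edge_sum (f : V -> V -> R) : R := beta / 2 * \sum_(x <- B) \sum_(y <- B | adj x y) f x y.

(* expo_re + I * expo_im is -beta times the Hamiltonian after the rotation of
   each spin x by the imaginary angle I * t * a x; twist_re and twist_im are the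
   real and imaginary parts of z_u * conj z_v * exp (-beta H) likewise. *)
Definition expo_re t s := edge_sum (fun x y => off (s x) (s y) + re (s x) (s y) * ch (t * dl x y)).
Definition expo_im t s := edge_sum (fun x y => - (im (s x) (s y) * sh (t * dl x y))).
Definition twist_re t s := expR (- (t * dl u v)) * (expR (expo_re t s) *
  (re (s u) (s v) * cos (expo_im t s) - im (s u) (s v) * sin (expo_im t s))).
Definition twist_im t s := expR (- (t * dl u v)) * (expR (expo_re t s) *
  (re (s u) (s v) * sin (expo_im t s) + im (s u) (s v) * cos (expo_im t s))).

Lemma observable_re x y : observable (fun s => re (s x) (s y)).
Proof.
by apply: observableD; apply: observableM; exact: observable_coord.
Qed.

Lemma observable_im x y : observable (fun s => im (s x) (s y)).
Proof.
by apply: observableD; last apply: observableN; apply: observableM; exact: observable_coord.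
Qed.

Lemma observable_dotp x y : observable (fun s : V -> spin R n => dotp (s x) (s y)).
Proof.
by apply: observable_sum => k; apply: observableM; exact: observable_coord.
Qed.

Lemma observable_off x y : observable (fun s => off (s x) (s y)).
Proof.
apply: observableD; first exact: observable_dotp.
apply: observableN; exact: observable_re.
Qed.

Lemma observable_edge_sum (f : (V -> spin R n) -> V -> V -> R) :
  (forall x y, observable (fun s => f s x y)) -> observable (fun s => edge_sum (f s)).
Proof.
move=> of_; apply: observableM; first exact: observable_cst.
by apply: observable_sum => x; apply: observable_sum => y.
Qed.

Lemma observable_expo_re t : observable (expo_re t).
Proof.
apply: observable_edge_sum => x y; apply: observableD; first exact: observable_off.
by apply: observableM; [exact: observable_re|exact: observable_cst].
Qed.

Lemma observable_expo_im t : observable (expo_im t).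
Proof.
apply: observable_edge_sum => x y; apply: observableN.
by apply: observableM; [exact: observable_im|exact: observable_cst].
Qed.

Lemma observable_twist_re t : observable (twist_re t).
Proof.
apply: observableM; first exact: observable_cst.
apply: observableM; first exact: observable_expR (observable_expo_re t).
apply: observableD; last apply: observableN; apply: observableM.
- exact: observable_re.
- exact: observable_cos (observable_expo_im t).
- exact: observable_im.
- exact: observable_sin (observable_expo_im t).
Qed.

Lemma observable_twist_im t : observable (twist_im t).
Proof.
apply: observableM; first exact: observable_cst.
apply: observableM; first exact: observable_expR (observable_expo_re t).
apply: observableD; apply: observableM.
- exact: observable_re.
- exact: observable_sin (observable_expo_im t).
- exact: observable_im.
- exact: observable_cos (observable_expo_im t).
Qed.

Let rho h : (V -> spin R n) -> V -> spin R n := act (fun x => rot_mx i j (h * a x)).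

(** The expansions in h must be uniform both in the size [p.1] of the imaginary rotation and in the
    configuration [p.2]. *)
Let D (p : R * (V -> spin R n)) := 0 <= p.1 <= 1 /\ in_balls p.2.

Lemma jet_edge_sum f f0 f1 : (forall x y, jet D (f x y) (f0 x y) (f1 x y)) ->
  jet D (fun h p => edge_sum (fun x y => f x y h p)) (fun p => edge_sum (fun x y => f0 x y p))
    (fun p => edge_sum (fun x y => f1 x y p)).
Proof.
move=> jf.
have jb := @jet_const R _ D (beta / 2).
have js : jet D (fun h p => \sum_(x <- B) \sum_(y <- B | adj x y) f x y h p)
    (fun p => \sum_(x <- B) \sum_(y <- B | adj x y) f0 x y p)
    (fun p => \sum_(x <- B) \sum_(y <- B | adj x y) f1 x y p).
  by apply: jet_sum => x; apply: jet_sum => y.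
by apply: (jet_ext (jetM jb js)) => // p _; rewrite mul0r add0r.
Qed.

Lemma jet_expR_shift c : jet D (fun h p => expR ((p.1 + h) * c))
  (fun p => expR (p.1 * c)) (fun p => c * expR (p.1 * c)).
Proof.
have jl : jet D (fun h p => p.1 * c + h * c) (fun p => p.1 * c) (fun=> c).
  apply: (jet_linear (M := `|c|)) => p [/andP[p0 p1] _]; split=> //.
  by rewrite normrM ger0_norm// ler_piMl.
by apply: (jet_ext (jet_expR jl)) => [h p|p|p] _ //; rewrite ?mulrDl// mulrC.
Qed.

Lemma jet_ch_shift c : jet D (fun h p => ch ((p.1 + h) * c))
  (fun p => ch (p.1 * c)) (fun p => c * sh (p.1 * c)).
Proof.
have j2 := @jet_const R _ D 2^-1.
apply: (jet_ext (jetM (jetD (jet_expR_shift c) (jet_expR_shift (- c))) j2));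
  by move=> *; rewrite /ch /sh ?mulrN//; ring.
Qed.

Lemma jet_sh_shift c : jet D (fun h p => sh ((p.1 + h) * c))
  (fun p => sh (p.1 * c)) (fun p => c * ch (p.1 * c)).
Proof.
have j2 := @jet_const R _ D 2^-1.
have jN := @jet_const R _ D (-1).
apply: (jet_ext (jetM (jetD (jet_expR_shift c) (jetM jN (jet_expR_shift (- c)))) j2));
  by move=> *; rewrite /ch /sh ?mulrN//; ring.
Qed.

Lemma jet_observable (F : (V -> spin R n) -> R) : observable F ->
  jet D (fun=> fun p => F p.2) (fun p => F p.2) (fun=> 0).
Proof. by move=> [_ [M FM]]; apply: (jet_cst (M := M)) => p [_]; exact: FM. Qed.

Lemma expR_bound t c : 0 <= t <= 1 -> `|expR (t * c)| <= expR `|c|.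
Proof.
move=> /andP[t0 t1]; rewrite ger0_norm ?expR_ge0// ler_expR (le_trans (ler_norm _))//.
by rewrite normrM ger0_norm// ler_piMl.
Qed.

Lemma jet_time_ch c : jet D (fun=> fun p => ch (p.1 * c)) (fun p => ch (p.1 * c)) (fun=> 0).
Proof.
apply: (jet_cst (M := expR `|c|)) => p [p01 _].
rewrite /ch normrM (ger0_norm (x := 2^-1))//.
have := expR_bound c p01; have := expR_bound (- c) p01; rewrite normrN mulrN => h1 h2.
have := ler_normD (expR (p.1 * c)) (expR (- (p.1 * c))); lra.
Qed.

Lemma jet_time_sh c : jet D (fun=> fun p => sh (p.1 * c)) (fun p => sh (p.1 * c)) (fun=> 0).
Proof.
apply: (jet_cst (M := expR `|c|)) => p [p01 _].
rewrite /sh normrM (ger0_norm (x := 2^-1))//.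
have := expR_bound c p01; have := expR_bound (- c) p01; rewrite normrN mulrN => h1 h2.
have := ler_normB (expR (p.1 * c)) (expR (- (p.1 * c))); lra.
Qed.

Lemma jet_rot c : [/\ jet D (fun h _ => cos (h * c)) (fun=> 1) (fun=> 0)
  & jet D (fun h _ => sin (h * c)) (fun=> 0) (fun=> c)].
Proof.
have jl : jet D (fun h _ => 0 + h * c) (fun=> 0) (fun=> c).
  by apply: (jet_linear (M := `|c|)) => p _; rewrite normr0.
split.
  apply: (jet_ext (jet_cos jl)) => *; rewrite ?add0r ?cos0//.
  by rewrite sin0 oppr0 mul0r.
apply: (jet_ext (jet_sin jl)) => *; rewrite ?add0r ?sin0//.
by rewrite cos0 mul1r.
Qed.

Lemma jet_re_rot x y : jet D (fun h p => re (rho h p.2 x) (rho h p.2 y))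
  (fun p => re (p.2 x) (p.2 y)) (fun p => - (dl x y * im (p.2 x) (p.2 y))).
Proof.
have [jc js] := jet_rot (dl x y).
have jr := jet_observable (observable_re x y).
have ji := jet_observable (observableN (observable_im x y)).
apply: (jet_ext (jetD (jetM jr jc) (jetM ji js))) => [h p _|p _|p _]; last 2 first.
- by ring.
- by ring.
by rewrite /rho /act plane_re_rot// -mulrBr /dl; ring.
Qed.

Lemma jet_im_rot x y : jet D (fun h p => im (rho h p.2 x) (rho h p.2 y))
  (fun p => im (p.2 x) (p.2 y)) (fun p => dl x y * re (p.2 x) (p.2 y)).
Proof.
have [jc js] := jet_rot (dl x y).
have jr := jet_observable (observable_re x y).
have ji := jet_observable (observable_im x y).
apply: (jet_ext (jetD (jetM ji jc) (jetM jr js))) => [h p _|p _|p _]; last 2 first.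
- by ring.
- by ring.
by rewrite /rho /act plane_im_rot// -mulrBr /dl; ring.
Qed.

(** [dP] and [dQ] are the derivatives of [expo_re] and [expo_im] along the imaginary rotation. Along
    the real rotation [rho] the derivatives are [dQ] and [- dP]: these are the Cauchy-Riemann
    equations of the exponent. *)
Let dP (p : R * (V -> spin R n)) :=
  edge_sum (fun x y => re (p.2 x) (p.2 y) * (dl x y * sh (p.1 * dl x y))).
Let dQ (p : R * (V -> spin R n)) :=
  edge_sum (fun x y => - (im (p.2 x) (p.2 y) * (dl x y * ch (p.1 * dl x y)))).

Lemma jet_expo_re_shift :
  jet D (fun h p => expo_re (p.1 + h) p.2) (fun p => expo_re p.1 p.2) dP.
Proof.
apply: jet_edge_sum => x y.
apply: (jet_ext (jetD (jet_observable (observable_off x y))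
  (jetM (jet_observable (observable_re x y)) (jet_ch_shift (dl x y))))) => // p _.
by ring.
Qed.

Lemma jet_expo_im_shift :
  jet D (fun h p => expo_im (p.1 + h) p.2) (fun p => expo_im p.1 p.2) dQ.
Proof.
apply: jet_edge_sum => x y.
by apply: (jet_ext (jetM (jet_observable (observableN (observable_im x y)))
  (jet_sh_shift (dl x y)))) => *; ring.
Qed.

Lemma jet_expo_re_rot :
  jet D (fun h p => expo_re p.1 (rho h p.2)) (fun p => expo_re p.1 p.2) dQ.
Proof.
apply: jet_edge_sum => x y.
apply: (jet_ext (jetD (jet_observable (observable_off x y))
  (jetM (jet_re_rot x y) (jet_time_ch (dl x y))))) => [h p _|//|p _].
  by rewrite /rho /act off_plane_rot.
by ring.
Qed.

Lemma jet_expo_im_rot :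
  jet D (fun h p => expo_im p.1 (rho h p.2)) (fun p => expo_im p.1 p.2) (fun p => - dP p).
Proof.
have J : jet D (fun h p => expo_im p.1 (rho h p.2)) (fun p => expo_im p.1 p.2)
    (fun p => edge_sum (fun x y => - (re (p.2 x) (p.2 y) * (dl x y * sh (p.1 * dl x y))))).
  apply: jet_edge_sum => x y.
  have jN := @jet_const R _ D (-1).
  by apply: (jet_ext (jetM jN (jetM (jet_im_rot x y) (jet_time_sh (dl x y))))) => *; ring.
apply: (jet_ext J) => //.
move=> p _; rewrite /dP /edge_sum -mulrN; congr (_ * _).
rewrite -sumrN; apply: eq_bigr => x _; rewrite -sumrN; exact: eq_bigr.
Qed.

(* The terms of order h cancel by the Cauchy-Riemann equations. *)
Lemma twist_increment : exists M, forall t h s, 0 <= t <= 1 -> 0 <= h <= 1 -> in_balls s ->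
  `|twist_re (t + h) s - twist_re t s + (twist_im t (rho h s) - twist_im t s)| <= M * h ^+ 2.
Proof.
pose c := dl u v.
have jN := @jet_const R _ D (-1).
have jE := jet_expR_shift (- c).
have jE0 : jet D (fun=> fun p => expR (p.1 * - c)) (fun p => expR (p.1 * - c)) (fun=> 0).
  by apply: (jet_cst (M := expR `|- c|)) => p [p01 _]; exact: expR_bound.
have jr := jet_observable (observable_re u v).
have ji := jet_observable (observable_im u v).
have jF := jetM jE (jetM (jet_expR jet_expo_re_shift)
  (jetD (jetM jr (jet_cos jet_expo_im_shift)) (jetM jN (jetM ji (jet_sin jet_expo_im_shift))))).
have jG := jetM jE0 (jetM (jet_expR jet_expo_re_rot)
  (jetD (jetM (jet_re_rot u v) (jet_sin jet_expo_im_rot))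
        (jetM (jet_im_rot u v) (jet_cos jet_expo_im_rot)))).
have [M _ HM] := jetD jF jG.
exists M => t h s t01 h01 sb.
have [_ _] := HM (t, s) (conj t01 sb) => /(_ _ h01) /=.
rewrite -[X in `|X| <= _ -> _]/(_ - _ - _).
apply: le_trans; rewrite le_eqVlt; apply/orP; left; apply/eqP; congr (`|_|).
rewrite /twist_re /twist_im -/c !mulrN.
(* Once the transcendental values are generalized, the cancellation of the first-order terms is a
   polynomial identity. *)
move: (expR (- ((t + h) * c))) (expR (- (t * c))) (expR (expo_re (t + h) s)) (expR (expo_re t s))
  (expR (expo_re t (rho h s))).
move: (cos (expo_im (t + h) s)) (cos (expo_im t s)) (cos (expo_im t (rho h s))).
move: (sin (expo_im (t + h) s)) (sin (expo_im t s)) (sin (expo_im t (rho h s))).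
move: (dP (t, s)) (dQ (t, s)) (re (s u) (s v)) (im (s u) (s v)).
move: (re (rho h s u) (rho h s v)) (im (rho h s u) (rho h s v)).
by rewrite -/c; move: (c); clear => *; ring.
Qed.

Let sigma1 : sigma (@sphere R n) = 1%E := sigma_unif.1.

Let s0 : V -> spin R n := fun=> [tuple 0 | _ < n].

Let s0_in_balls : in_balls s0.
Proof.
move=> x; rewrite /dotp big1 ?ler01// => k _.
by rewrite !tnth_mktuple mulr0.
Qed.

(** The spins outside the ball are 0 and do not move, so [spin_integral_act] becomes a true
    invariance. *)
Let act_s0 (A : V -> 'M[R]_n) : act A s0 = s0.
Proof.
apply/funext => x; apply: eq_from_tnth => k; rewrite !tnth_mktuple big1// => l _.
by rewrite tnth_mktuple mulr0.
Qed.

(** Up to O(h ^ 2), the increment in t of the integral of [twist_re] is minus the change of the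
    integral of [twist_im] under the real rotation [rho h], which is 0 by invariance. *)
Lemma spin_integral_twist :
  spin_integral sigma B (twist_re 1) s0 = spin_integral sigma B (twist_re 0) s0.
Proof.
have [M HM] := twist_increment.
apply: (@eq_of_quadratic_increments R (fun t => spin_integral sigma B (twist_re t) s0) M).
move=> t h t01 h01.
have oR k := observable_twist_re k; have oI := observable_twist_im t.
have Orho x : orthogonal_mx (rot_mx i j (h * a x)) by exact: orthogonal_rot_mx.
have oIr : observable (fun s => twist_im t (rho h s)) by exact: observable_act.
have eI : spin_integral sigma B (fun s => twist_im t (rho h s)) s0 =
    spin_integral sigma B (twist_im t) s0.
  by rewrite (spin_integral_act sigma1 sigma_unif.2)// act_s0.
have := spin_integral_norm_le sigma1 B
  (observableD (observableD (oR (t + h)) (observableN (oR t)))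
               (observableD oIr (observableN oI)))
  (observable_cst V n (M * h ^+ 2)) (fun s => HM t h s t01 h01) s0_in_balls.
rewrite spin_integral_cst// !(spin_integralD sigma1, spin_integralN sigma1)//.
- by rewrite eI subrr addr0.
- exact: observableN.
- exact: observableN.
- exact: observableD (oR _) (observableN (oR _)).
- exact: observableD oIr (observableN oI).
Qed.

Local Notation H := (hamiltonian adj B).

Lemma observable_boltzmann : observable (fun s => expR (- beta * H s)).
Proof.
apply: observable_expR; apply: observableM; first exact: observable_cst.
apply: observableN; apply: observableM; first exact: observable_cst.
by apply: observable_sum => x; apply: observable_sum => y; exact: observable_dotp.
Qed.

Lemma ch0 : ch 0 = 1.
Proof. by rewrite /ch oppr0 expR0; field. Qed.

Lemma ch_ge1 t : 1 <= ch t.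
Proof. by have := expR_ge1Dx t; have := expR_ge1Dx (- t); rewrite /ch; lra. Qed.

Lemma expo_re0 s : expo_re 0 s = - beta * H s.
Proof.
rewrite /expo_re /edge_sum /hamiltonian mulrNN mulrA; congr (_ * _).
apply: eq_bigr => x _; apply: eq_bigr => y _.
by rewrite mul0r ch0 mulr1 subrK.
Qed.

Lemma twist_re0 s : twist_re 0 s = re (s u) (s v) * expR (- beta * H s).
Proof.
rewrite /twist_re expo_re0 mul0r oppr0 expR0 mul1r.
have -> : expo_im 0 s = 0.
  rewrite /expo_im /edge_sum big1 ?mulr0// => x _; rewrite big1// => y _.
  by rewrite mul0r /sh oppr0 subrr mul0r mulr0 oppr0.
by rewrite cos0 sin0 mulr0 subr0 mulr1 mulrC.
Qed.

Hypothesis beta_gt0 : 0 < beta.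

(** Only the planar part of the energy changes, being multiplied by [ch] >= 1. It is at most 2 on
    each edge, and this 2 cancels the 1/2 in [edge_sum]. *)
Lemma expo_re1_le s : in_balls s -> expo_re 1 s <=
  - beta * H s + beta * \sum_(x <- B) \sum_(y <- B | adj x y) (ch (a x - a y) - 1).
Proof.
move=> sb; rewrite -expo_re0 -lerBlDl /expo_re /edge_sum -mulrBr -sumrB.
set E := \sum_(x <- B) \sum_(y <- B | adj x y) (ch (a x - a y) - 1).
rewrite [leRHS](_ : beta * E = beta / 2 * (2 * E)); last by field.
rewrite ler_wpM2l ?divr_ge0 ?(ltW beta_gt0)// /E mulr_sumr.
apply: ler_sum => x _; rewrite -sumrB mulr_sumr; apply: ler_sum => y _.
rewrite mul1r mul0r ch0 -/(dl x y).
have := ch_ge1 (dl x y); have := plane_re_bound i j (sb x) (sb y).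
by rewrite ler_norml => /andP[_ h1] h2; nra.
Qed.

(** After the rotation is moved from time 0 to time 1, the integrand is bounded pointwise: the
    imaginary part of the exponent enters only through cos and sin, and [expo_re1_le] controls the
    real part. The 4 is 2 + 2, from [plane_re] and [plane_im]. *)
Lemma plane_correlation_bound :
  `|spin_integral sigma B (fun s => re (s u) (s v) * expR (- beta * H s)) s0| <=
  4 * expR (- (a u - a v) + beta * \sum_(x <- B) \sum_(y <- B | adj x y) (ch (a x - a y) - 1))
  * spin_integral sigma B (fun s => expR (- beta * H s)) s0.
Proof.
rewrite (_ : (fun s => _) = twist_re 0); last by apply/funext => s; rewrite twist_re0.
rewrite -spin_integral_twist -spin_integralZ//; last exact: observable_boltzmann.
apply: spin_integral_norm_le => //; first exact: observable_twist_re.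
  by apply: observableM; [exact: observable_cst|exact: observable_boltzmann].
move=> s sb; rewrite /twist_re mul1r !normrM !(ger0_norm (expR_ge0 _)).
set E := \sum_(x <- B) _.
have b1 : `|re (s u) (s v) * cos (expo_im 1 s) - im (s u) (s v) * sin (expo_im 1 s)| <= 4.
  have m (x y : R) : `|x| <= 2 -> `|y| <= 1 -> `|x * y| <= 2.
    by move=> x2 y1; rewrite normrM -[2]mulr1 ler_pM.
  rewrite (le_trans (ler_normB _ _))//.
  have := m _ _ (plane_re_bound i j (sb u) (sb v)) (cos_max (expo_im 1 s)).
  have := m _ _ (plane_im_bound i j (sb u) (sb v)) (sin_max (expo_im 1 s)).
  lra.
rewrite [leRHS](_ : _ = expR (- dl u v) * (expR (- beta * H s + beta * E) * 4)); last first.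
  by rewrite !expRD /dl; ring.
by rewrite ler_wpM2l ?expR_ge0// ler_pM ?expR_ge0// ler_expR expo_re1_le.
Qed.

End McBryanSpencer.

(** * From coordinate planes to the full inner product *)

Section CorrelationBound.
Variables (R : realType) (V : choiceType) (adj : rel V) (n : nat).
Variable sigma : probability (spin R n) R.
Hypothesis sigma_unif : uniform_on_sphere sigma.

(** In the cyclic list of pairs of consecutive coordinates every coordinate occurs twice, hence the
    factor 1/2. *)
Lemma dotp_plane_re (x y : spin R n) : (1 < n)%N ->
  dotp x y = 2^-1 * \sum_k plane_re k (ordS k) x y.
Proof.
move=> n1; rewrite /plane_re big_split /=.
rewrite -(reindex_inj (P := xpredT) (F := fun k => tnth x k * tnth y k) (@ordS_inj n)).
by rewrite -/(dotp x y); field.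
Qed.

Lemma ordS_neq k : (1 < n)%N -> k != ordS k :> 'I_n.
Proof.
move=> n1; apply/eqP => /(congr1 val) /= kS.
have := ltn_ord k; rewrite leq_eqVlt => /orP[/eqP kn|kn].
  by move: kS; rewrite kn modnn => k0; move: n1; rewrite -kn k0.
by move: kS; rewrite modn_small// => /n_Sn.
Qed.

Lemma ball_correlation_bound (beta : R) (o : V) (a : V -> R) (u v : V) (r : nat) :
  (1 < n)%N -> 0 < beta ->
  `|ball_correlation adj sigma o beta u v r| <=
  2 * n%:R * expR (- (a u - a v) + beta *
    \sum_(x <- gball adj o r) \sum_(y <- gball adj o r | adj x y) (ch (a x - a y) - 1)).
Proof.
move=> n1 beta0; rewrite /ball_correlation /gibbs_integral.
set B := gball adj o r; set E := expR _.
have sigma1 := sigma_unif.1.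
set s0 : V -> spin R n := fun=> [tuple 0 | _ < n].
have s0b : in_balls s0.
  move=> x; rewrite /dotp big1 ?ler01// => k _.
  by rewrite !tnth_mktuple mulr0.
rewrite (_ : (fun s => 1 * _) = fun s => expR (- beta * hamiltonian adj B s)); last first.
  by apply/funext => s; rewrite mul1r.
set Z := spin_integral sigma B (fun s => expR _) s0.
have Z0 : 0 <= Z.
  rewrite -(spin_integral_cst sigma1 B 0 s0).
  apply: le_spin_integral => //; first exact: observable_cst.
  exact: observable_boltzmann.
suff num : `|spin_integral sigma B
      (fun s => dotp (s u) (s v) * expR (- beta * hamiltonian adj B s)) s0|
    <= 2 * n%:R * E * Z.
  rewrite normrM normfV (ger0_norm Z0).
  (* Division by 0 yields 0, so the bound is trivial if [Z] vanishes. *)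
  have [->|Zn0] := eqVneq Z 0; first by rewrite invr0 mulr0 !mulr_ge0 ?expR_ge0.
  by rewrite ler_pdivrMr// lt_def Zn0.
pose G k (s : V -> spin R n) :=
  plane_re k (ordS k) (s u) (s v) * expR (- beta * hamiltonian adj B s).
have oG k : observable (G k).
  by apply: observableM; [exact: observable_re|exact: observable_boltzmann].
rewrite (_ : (fun s => _) = fun s => 2^-1 * \sum_(k <- index_enum 'I_n) G k s); last first.
  by apply/funext => s; rewrite dotp_plane_re// -mulrA mulr_suml.
rewrite spin_integralZ//; last exact: observable_sum.
rewrite spin_integral_sum// normrM ger0_norm//.
apply: (@le_trans _ _ (2^-1 * \sum_(k < n) (4 * E * Z))).
  rewrite ler_wpM2l// (le_trans (ler_norm_sum _ _ _))//.
  by apply: ler_sum => k _; apply: plane_correlation_bound => //; exact: ordS_neq.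
rewrite sumr_const card_ord -mulr_natl le_eqVlt; apply/orP; left; apply/eqP.
by field.
Qed.

End CorrelationBound.

(** * The logarithmic radius in the half-plane *)

Section HalfPlane.
Variable R : realType.
Implicit Types (z w : hplane R) (p : R).

Definition abscissa z : R := (sval z).1.
Definition height z : R := (sval z).2.

Lemma height_gt0 z : 0 < height z.
Proof. exact: (svalP z). Qed.

(** This is cosh of the hyperbolic distance, minus 1. *)
Definition qdist z w := ((abscissa z - abscissa w) ^+ 2 + (height z - height w) ^+ 2) /
  (2 * height z * height w).

Lemma hdistE z w : hdist z w = arcosh (1 + qdist z w).
Proof. by rewrite /hdist /qdist /abscissa /height; case: (sval z) (sval w) => ? ? []. Qed.

Lemma qdistC z w : qdist z w = qdist w z.
Proof. by rewrite /qdist; congr (_ / _); ring. Qed.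

Lemma hdistC z w : hdist z w = hdist w z.
Proof. by rewrite !hdistE qdistC. Qed.

Lemma qdist_ge0 z w : 0 <= qdist z w.
Proof.
rewrite divr_ge0 ?addr_ge0 ?sqr_ge0//.
by rewrite !mulr_ge0 ?(ltW (height_gt0 _)).
Qed.

(** Since exp (arcosh t) = t + sqrt (t ^ 2 - 1) lies between t and 2 * t, this bound and
    [hdist_le_ln] determine the distance up to ln 2. *)
Lemma le_expR_hdist z w : 1 + qdist z w <= expR (hdist z w).
Proof.
have q0 := qdist_ge0 z w; rewrite hdistE /arcosh lnK.
  by rewrite lerDl sqrtr_ge0.
by rewrite posrE ltr_wpDr ?sqrtr_ge0//; lra.
Qed.

Lemma hdist_le_ln z w M : qdist z w <= M -> hdist z w <= ln (2 * (1 + M)).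
Proof.
have q0 := qdist_ge0 z w => qM; rewrite hdistE /arcosh ler_ln ?posrE.
- have : Num.sqrt ((1 + qdist z w) ^+ 2 - 1) <= 1 + qdist z w.
    rewrite -[leRHS]ger0_norm -?sqrtr_sqr; last by lra.
    by apply: ler_wsqrtr; lra.
  lra.
- by rewrite ltr_wpDr ?sqrtr_ge0//; lra.
- by lra.
Qed.

Definition rad2 p z := (abscissa z - p) ^+ 2 + height z ^+ 2.
(** The level sets are the semicircles around p, which are the geodesics orthogonal to the vertical
    one over p; the value is the arc length coordinate of the projection of z to the latter. *)
Definition lograd p z := ln (rad2 p z) / 2.
(* The squared hyperbolic norm of the gradient of lograd p *)
Definition weight p z := height z ^+ 2 / rad2 p z.

Lemma rad2_gt0 p z : 0 < rad2 p z.
Proof. by rewrite ltr_wpDl ?sqr_ge0// exprn_gt0// height_gt0. Qed.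

Lemma weight_ge0 p z : 0 <= weight p z.
Proof. by rewrite divr_ge0 ?sqr_ge0// ltW// rad2_gt0. Qed.

Lemma weight_le1 p z : weight p z <= 1.
Proof. by rewrite ler_pdivrMr ?rad2_gt0// mul1r lerDr sqr_ge0. Qed.

Lemma euclidean_le_height z w D : hdist z w <= D ->
  (abscissa z - abscissa w) ^+ 2 + (height z - height w) ^+ 2 <= (2 * expR D * height z) ^+ 2.
Proof.
move=> zwD; set e := expR D.
have zh := height_gt0 z; have wh := height_gt0 w.
have q1 : 1 + qdist z w <= e by rewrite (le_trans (le_expR_hdist _ _))// ler_expR.
have e1 : 1 <= e by have := qdist_ge0 z w; lra.
set S := _ + _.
have S2 : S <= (e - 1) * (2 * height z * height w).
  rewrite -ler_pdivrMr ?mulr_gt0//; by move: q1; rewrite /qdist -/S; lra.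
(* The vertical part of [S2] alone gives height w ^ 2 <= 2 * e * height z * height w. *)
have wz : height w <= 2 * e * height z.
  rewrite leNgt; apply/negP => hw.
  have h1 : (height z - height w) ^+ 2 <= (e - 1) * (2 * height z * height w).
    by apply: le_trans S2; rewrite lerDr sqr_ge0.
  have : 2 * e * height z * height w < height w * height w by rewrite ltr_pM2r.
  nra.
have : (e - 1) * (2 * height z * height w) <= (e - 1) * (2 * height z * (2 * e * height z)).
  by rewrite ler_wpM2l ?subr_ge0// ler_wpM2l// ltW// mulr_gt0.
move=> h; apply: (le_trans S2); apply: (le_trans h).
have : 0 <= height z ^+ 2 * e by rewrite mulr_ge0 ?sqr_ge0//; lra.
by nra.
Qed.

(** By [euclidean_le_height] and the triangle inequality, |w - p| <= |z - p| + 2 * exp D * height z;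
    then ln (1 + x) <= x. *)
Lemma lograd_increment p z w D : hdist z w <= D ->
  lograd p w - lograd p z <= 2 * expR D * (height z / Num.sqrt (rad2 p z)).
Proof.
move=> /euclidean_le_height; set K := 2 * expR D => near.
have zh := height_gt0 z; have r0 := rad2_gt0 p z.
set S := Num.sqrt (rad2 p z).
have S0 : 0 < S by rewrite sqrtr_gt0.
have S2 : S ^+ 2 = rad2 p z by rewrite sqr_sqrtr// ltW.
pose m := K * height z.
have m0 : 0 < m by rewrite !mulr_gt0// expR_gt0.
have rw : rad2 p w <= (S + m) ^+ 2.
  pose a := abscissa z - p; pose b := height z.
  pose c := abscissa w - abscissa z; pose d := height w - height z.
  have cd : c ^+ 2 + d ^+ 2 <= m ^+ 2.
    by apply: le_trans near; rewrite /c /d le_eqVlt; apply/orP; left; apply/eqP; ring.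
  have ab : a ^+ 2 + b ^+ 2 = S ^+ 2 by rewrite S2.
  have cs : a * c + b * d <= S * m.
    rewrite (le_trans (ler_norm _))// -ler_sqr ?nnegrE ?(mulr_ge0 (ltW S0) (ltW m0))//.
    rewrite real_normK ?num_real// exprMn -ab.
    apply: (@le_trans _ _ ((a ^+ 2 + b ^+ 2) * (c ^+ 2 + d ^+ 2))).
      rewrite (_ : (a ^+ 2 + _) * _ = (a * c + b * d) ^+ 2 + (a * d - b * c) ^+ 2).
        by rewrite lerDl sqr_ge0.
      by ring.
    by rewrite ler_wpM2l// addr_ge0 ?sqr_ge0.
  rewrite (_ : rad2 p w = (a + c) ^+ 2 + (b + d) ^+ 2); last first.
    by rewrite /rad2 /a /b /c /d; ring.
  rewrite (_ : _ + _ = (a ^+ 2 + b ^+ 2) + 2 * (a * c + b * d) + (c ^+ 2 + d ^+ 2)); last by ring.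
  rewrite ab; nra.
have lw : ln (rad2 p w) <= 2 * (ln S + m / S).
  apply: (@le_trans _ _ (ln ((S + m) ^+ 2))).
    by rewrite ler_ln ?posrE ?rad2_gt0// exprn_gt0// addr_gt0.
  rewrite lnXn ?addr_gt0// -[leLHS]mulr_natl ler_wpM2l//.
  rewrite (_ : S + m = S * (1 + m / S)); last by field; rewrite gt_eqF.
  rewrite lnM ?posrE// ?lerD2l ?addr_gt0 ?divr_gt0//.
  by rewrite le_ln1Dx// (lt_trans (ltrN10 _))// divr_gt0.
have lz : ln (rad2 p z) = 2 * ln S by rewrite -S2 lnXn// mulr_natl.
by rewrite /lograd lz mulrA -/m; lra.
Qed.

(** The one-sided bound is applied from z or from w according to the sign of the difference, so both
    weights appear. *)
Lemma lograd_edge p z w D : hdist z w <= D ->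
  (lograd p z - lograd p w) ^+ 2 <= (2 * expR D) ^+ 2 * (weight p z + weight p w).
Proof.
move=> zwD.
have sq z' : (height z' / Num.sqrt (rad2 p z')) ^+ 2 = weight p z'.
  by rewrite expr_div_n sqr_sqrtr// ltW// rad2_gt0.
have h1 := lograd_increment p zwD.
have wzD : hdist w z <= D by rewrite hdistC.
have h2 := lograd_increment p wzD.
move: (sq z) (sq w) h1 h2; set gz := _ / Num.sqrt _; set gw := _ / Num.sqrt _; set K := 2 * expR D.
have K0 : 0 <= K by rewrite mulr_ge0// expR_ge0.
move=> <- <- h1 h2.
set x := lograd p z - lograd p w in h2 *.
have {}h1 : - x <= K * gz by rewrite /x opprB.
have gz0 := sqr_ge0 (K * gz); have gw0 := sqr_ge0 (K * gw).
rewrite mulrDr -!exprMn.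
have [x0|x0] := leP 0 x; nra.
Qed.

Lemma lograd_edge_norm p z w D : hdist z w <= D ->
  `|lograd p z - lograd p w| <= 2 * (2 * expR D).
Proof.
move=> /(lograd_edge p) h; have e0 := expR_ge0 D.
rewrite -ler_sqr ?nnegrE ?mulr_ge0// real_normK ?num_real//.
apply: (le_trans h).
have := weight_le1 p z; have := weight_le1 p w.
have := sqr_ge0 (2 * expR D); nra.
Qed.

(* The geodesic between two points rises to a height comparable to their
   Euclidean distance; seen from the foot of the lower point, half of it is
   traversed radially. *)
Lemma lograd_separates z w : exists p,
  hdist z w <= ln 6 + 2 * `|lograd p z - lograd p w|.
Proof.
wlog zw : z w / height z <= height w => [hw|].
  have [/hw//|/ltW/hw[p hp]] := leP (height z) (height w).
  by exists p; rewrite hdistC distrC.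
have zh := height_gt0 z; have wh := height_gt0 w.
exists (abscissa z); set p := abscissa z.
have rz : rad2 p z = height z ^+ 2 by rewrite /rad2 subrr expr0n add0r.
have rr : height z ^+ 2 <= rad2 p w.
  by rewrite /rad2; have := sqr_ge0 (abscissa w - p); nra.
pose Q := rad2 p w / height z ^+ 2.
have hz2 : 0 < height z ^+ 2 by rewrite exprn_gt0.
have Q1 : 1 <= Q by rewrite ler_pdivlMr// mul1r.
(* As z is the lower point, the numerator of [qdist] is at most rad2 p w and the denominator at
   least height z ^ 2. *)
have qQ : qdist z w <= Q.
  rewrite /qdist /Q ler_pdivrMr ?mulr_gt0// mulrAC ler_pdivlMr//.
  apply: (@le_trans _ _ (rad2 p w * height z ^+ 2)).
    rewrite ler_wpM2r ?sqr_ge0// /rad2 -sqrrN opprB lerD2l.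
    by nra.
  rewrite ler_wpM2l ?ltW ?rad2_gt0//; nra.
have e2 : 2 * (lograd p w - lograd p z) = ln Q.
  by rewrite /lograd rz /Q ln_div ?posrE ?rad2_gt0//; field.
have : ln Q <= 2 * `|lograd p z - lograd p w|.
  by rewrite -e2 distrC ler_wpM2l// ler_norm.
suff : hdist z w <= ln 6 + ln Q by lra.
apply: (le_trans (hdist_le_ln qQ)); rewrite -lnM ?posrE//; last by lra.
by rewrite ler_ln ?posrE//; lra.
Qed.

End HalfPlane.

(** * Whitney cells of the half-plane *)

Section WhitneyCells.
Variable R : realType.
Implicit Types (z w : hplane R) (p : R).

(** Strips between consecutive powers of e are cut into cells about as wide as they are high,
    counted outwards from the abscissa p. A pair of [level] and [column] thus describes two mirror
    cells, told apart by the side of p. *)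
Definition level z : int := Num.floor (ln (height z)).
Definition scale z : R := expR (level z)%:~R.
Definition column p z : nat := Num.truncn (`|abscissa z - p| / scale z).

Lemma scale_gt0 z : 0 < scale z. Proof. exact: expR_gt0. Qed.

Lemma scale_le_height z : scale z <= height z.
Proof.
rewrite -[leRHS]lnK ?posrE ?height_gt0// ler_expR; exact: floor_le_tmp.
Qed.

Lemma height_le_scale z : height z <= expR 1 * scale z.
Proof.
rewrite -[leLHS]lnK ?posrE ?height_gt0// -expRD ler_expR addrC ltW//.
by rewrite -intrD1 floorD1_gt.
Qed.

Lemma column_bounds p z : (column p z)%:R * scale z <= `|abscissa z - p| /\
  `|abscissa z - p| <= ((column p z)%:R + 1) * scale z.
Proof.
have s0 := scale_gt0 z.
have /truncn_itv/andP[h1 h2] : 0 <= `|abscissa z - p| / scale z.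
  by rewrite divr_ge0 ?normr_ge0// ltW.
split; first by rewrite -ler_pdivlMr.
by rewrite -ler_pdivrMr// natr1 ltW.
Qed.

Lemma rad2_lower p z : ((column p z)%:R ^+ 2 + 1) * scale z ^+ 2 <= rad2 p z.
Proof.
have [h1 _] := column_bounds p z; have h2 := scale_le_height z; have s0 := scale_gt0 z.
rewrite /rad2 mulrDl mul1r -exprMn lerD//.
  by rewrite -[leRHS]real_normK ?num_real// ler_sqr ?nnegrE// mulr_ge0// ltW.
by rewrite ler_sqr ?nnegrE ?(ltW s0) ?(ltW (height_gt0 _)).
Qed.

Lemma rad2_upper p z :
  rad2 p z <= (2 + expR 1 ^+ 2) * (((column p z)%:R ^+ 2 + 1) * scale z ^+ 2).
Proof.
have [_ h1] := column_bounds p z; have h2 := height_le_scale z; have s0 := scale_gt0 z.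
set J := (column p z)%:R in h1 *.
have J0 : 0 <= J by rewrite ler0n.
have a1 : (abscissa z - p) ^+ 2 <= ((J + 1) * scale z) ^+ 2.
  by rewrite -real_normK ?num_real// ler_sqr ?nnegrE// mulr_ge0 ?addr_ge0// ltW.
have a2 : height z ^+ 2 <= (expR 1 * scale z) ^+ 2.
  by rewrite ler_sqr ?nnegrE ?mulr_ge0 ?expR_ge0 ?(ltW s0) ?(ltW (height_gt0 _)).
rewrite /rad2; apply: (le_trans (lerD a1 a2)).
rewrite !exprMn mulrA -mulrDl ler_wpM2r ?sqr_ge0//.
have := sqr_ge0 (J - 1); have : 0 <= expR 1 ^+ 2 * J ^+ 2 :> R by rewrite mulr_ge0 ?sqr_ge0.
by nra.
Qed.

(** The decay in the column makes the weights of one level summable, through [sum_inv_sqr]. *)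
Lemma weight_le_column p z : weight p z <= expR 1 ^+ 2 / ((column p z)%:R ^+ 2 + 1).
Proof.
have s0 := scale_gt0 z; have r0 := rad2_gt0 p z.
have j0 : 0 < (column p z)%:R ^+ 2 + 1 :> R by rewrite ltr_wpDl// sqr_ge0.
rewrite ler_pdivrMr// mulrAC ler_pdivlMr//.
apply: (@le_trans _ _ ((expR 1 * scale z) ^+ 2 * ((column p z)%:R ^+ 2 + 1))).
  rewrite ler_wpM2r ?(ltW j0)// ler_sqr ?nnegrE ?height_le_scale//.
    by rewrite ltW// height_gt0.
  by rewrite mulr_ge0 ?expR_ge0 ?(ltW s0).
rewrite exprMn -mulrA ler_wpM2l ?sqr_ge0// mulrC; exact: rad2_lower.
Qed.

Definition column_shift (J : nat) : R := ln (J%:R ^+ 2 + 1) / 2.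
Definition cell_height : R := ln (2 + expR 1 ^+ 2) / 2.

(** Logarithms of [rad2_lower] and [rad2_upper]. Hence, in a fixed column, the values of [lograd] in
    an interval come from a number of levels bounded by its length plus a constant. *)
Lemma lograd_cell p z : (level z)%:~R + column_shift (column p z) <= lograd p z
  <= (level z)%:~R + column_shift (column p z) + cell_height.
Proof.
have j0 : 0 < (column p z)%:R ^+ 2 + 1 :> R by rewrite ltr_wpDl// sqr_ge0.
have e0 : 0 < 2 + expR 1 ^+ 2 :> R by rewrite ltr_wpDr// sqr_ge0.
have s0 := scale_gt0 z; have s2 : 0 < scale z ^+ 2 by rewrite exprn_gt0.
have lnS : ln (scale z ^+ 2) = 2 * (level z)%:~R.
  by rewrite lnXn// /scale expRK mulr_natl.
have jS0 : 0 < ((column p z)%:R ^+ 2 + 1) * scale z ^+ 2 by rewrite mulr_gt0.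
have hU : ln (rad2 p z) <= ln ((2 + expR 1 ^+ 2) * (((column p z)%:R ^+ 2 + 1) * scale z ^+ 2)).
  by rewrite ler_ln ?posrE ?rad2_gt0 ?rad2_upper ?(mulr_gt0 e0 jS0).
have hL : ln (((column p z)%:R ^+ 2 + 1) * scale z ^+ 2) <= ln (rad2 p z).
  by rewrite ler_ln ?posrE ?rad2_gt0 ?rad2_lower.
move: hU; rewrite (@lnM _ (2 + expR 1 ^+ 2)) ?posrE// => hU.
move: hU hL; rewrite (@lnM _ _ (scale z ^+ 2)) ?posrE// lnS.
by move=> hU hL; rewrite /lograd /column_shift /cell_height; apply/andP; split; lra.
Qed.

(** With s the common scale, the abscissae differ by at most s and the heights by at most e * s,
    while both heights are at least s; so [qdist] is at most 1 + e ^ 2. *)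
Lemma same_cell_near p z w : (p <= abscissa z) = (p <= abscissa w) ->
  column p z = column p w ->
  level z = level w ->
  hdist z w <= ln (2 * (2 + expR 1 ^+ 2)).
Proof.
move=> sg J k.
have sE : scale z = scale w by rewrite /scale k.
have [z1 z2] := column_bounds p z; have [w1 w2] := column_bounds p w.
have y1 := scale_le_height z; have y2 := height_le_scale z.
have y3 := scale_le_height w; have y4 := height_le_scale w.
rewrite -J -sE in w1 w2; rewrite -sE in y3 y4.
have s0 := scale_gt0 z; set s := scale z in z1 z2 w1 w2 y1 y2 y3 y4 s0.
set j := (column p z)%:R in z1 z2 w1 w2.
have dx : (abscissa z - abscissa w) ^+ 2 <= s ^+ 2.
  have : `|abscissa z - abscissa w| <= s.
    have pz : 0 <= abscissa z - p = (p <= abscissa z) by rewrite subr_ge0.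
    have pw : 0 <= abscissa w - p = (p <= abscissa w) by rewrite subr_ge0.
    rewrite ler_norml; case: (boolP (p <= abscissa z)) sg => hz /esym hw.
      rewrite !ger0_norm ?pz ?pw// in z1 z2 w1 w2.
      by apply/andP; split; nra.
    have {}hz : abscissa z - p < 0 by rewrite ltNge pz.
    have {}hw : abscissa w - p < 0 by rewrite ltNge pw hw.
    rewrite !ltr0_norm// in z1 z2 w1 w2.
    by apply/andP; split; nra.
  by move=> h; rewrite -[leLHS]real_normK ?num_real// ler_sqr ?nnegrE// ltW.
have e0 := expR_gt0 (1 : R).
have dy : (height z - height w) ^+ 2 <= expR 1 ^+ 2 * s ^+ 2.
  rewrite -exprMn -[leLHS]real_normK ?num_real// ler_sqr ?nnegrE ?(mulr_ge0 (ltW e0) (ltW s0))//.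
  by rewrite ler_norml; apply/andP; split; lra.
rewrite (_ : 2 + expR 1 ^+ 2 = 1 + (1 + expR 1 ^+ 2)); last by ring.
apply: hdist_le_ln; rewrite /qdist ler_pdivrMr ?mulr_gt0 ?height_gt0//.
have hh : s * s <= height z * height w by rewrite ler_pM// (ltW s0).
have e20 := sqr_ge0 (expR 1 : R).
have hE : s ^+ 2 * (1 + expR 1 ^+ 2) <= (height z * height w) * (1 + expR 1 ^+ 2).
  by rewrite ler_wpM2r// addr_ge0.
have : 0 <= (height z * height w) * (1 + expR 1 ^+ 2).
  by rewrite !mulr_ge0 ?addr_ge0 ?(ltW (height_gt0 _)).
nra.
Qed.

End WhitneyCells.

(** * Counting in the graph *)

Section GraphBalls.
Variables (V : choiceType) (adj : rel V).

Lemma neighbour_seq : bounded_degree adj -> exists (D : nat) (nb : V -> seq V),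
  forall v, (size (nb v) <= D)%N /\ forall w, adj v w -> w \in nb v.
Proof.
move=> [D HD]; exists D, (fun v => fset_set [set w | adj v w] : seq V) => v.
split; first exact: geq_card_fset_set (HD v).
move=> w vw; rewrite in_fset_set ?inE//.
exact: card_le_finite (HD v) (finite_II D).
Qed.

Lemma gdist_walk u v : connected_graph adj -> walk adj u v (gdist adj u v).
Proof.
move=> conn; rewrite /gdist; case: xgetP => [k _ [//]|none].
have ex : exists k, `[< walk adj u v k >] by have [k] := conn u v; exists k; exact/asboolP.
case: (ex_minnP ex) => m /asboolP um minm.
by case: (none m); split=> // m' um'; apply: minm; exact/asboolP.
Qed.

Lemma gdist_le u v k : walk adj u v k -> (gdist adj u v <= k)%N.
Proof.
by move=> uv; rewrite /gdist; case: xgetP => [m _ [_]|//]; exact.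
Qed.

Lemma gdist_adj u v : adj u v -> (gdist adj u v <= 1)%N.
Proof. by move=> uv; apply: gdist_le; exists [:: v]; rewrite /= uv. Qed.

Lemma ball_growth : connected_graph adj -> bounded_degree adj ->
  forall r, exists N, forall x (S : seq V), uniq S ->
  (forall y, y \in S -> (gdist adj x y <= r)%N) -> (size S <= N)%N.
Proof.
move=> conn /neighbour_seq[D [nb nbP]].
(* At most D ^ k end points of walks of length k, uniformly in the starting point. *)
have sphere_seq k : exists N, forall x, exists L : seq V, (size L <= N)%N /\
    forall y, walk adj x y k -> y \in L.
  elim: k => [|k [N HN]].
    exists 1%N => x; exists [:: x]; split=> // y [[|? ?] [//= _ <- _]].
    by rewrite inE.
  exists (D * N)%N => x.
  have [L LP] := choice HN.
  exists (flatten [seq L w | w <- nb x]); split.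
    have [nbD _] := nbP x; apply: (@leq_trans (size (nb x) * N)).
      elim: (nb x) => //= w l IH; rewrite size_cat mulSn leq_add//.
      by have [] := LP w.
    by rewrite leq_mul2r nbD orbT.
  move=> y [[|w p] [//= /andP[xw wp] wy [pk]]].
  apply/flatten_mapP; exists w; first exact: (nbP x).2.
  by apply: (LP w).2; exists p.
move=> r.
have ball_seq : exists N, forall x, exists L : seq V, (size L <= N)%N /\
    forall y k, (k <= r)%N -> walk adj x y k -> y \in L.
  elim: r => [|r [N HN]].
    have [N HN] := sphere_seq 0; exists N => x; have [L [LN HL]] := HN x.
    by exists L; split=> // y k; rewrite leqn0 => /eqP ->; exact: HL.
  have [N' HN'] := sphere_seq r.+1; exists (N + N')%N => x.
  have [L [LN HL]] := HN x; have [L' [LN' HL']] := HN' x.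
  exists (L ++ L'); split; first by rewrite size_cat leq_add.
  move=> y k; rewrite leq_eqVlt mem_cat => /orP[/eqP -> /HL' -> |kr /(HL y k kr) ->//].
  by rewrite orbT.
have [N HN] := ball_seq; exists N => x S US HS.
have [L [LN HL]] := HN x; apply: leq_trans LN.
apply: uniq_leq_size US _ => y /HS yr; apply: HL yr _; exact: gdist_walk.
Qed.

End GraphBalls.

(** * Sums over cells *)

Section Counting.
Variable R : realType.

Lemma sum_inv_sqr n : \sum_(k < n) (k%:R ^+ 2 + 1)^-1 <= 6 :> R.
Proof.
(* Telescoping: the term of index k is at most 6 / (k + 1) - 6 / (k + 2). *)
suff h : \sum_(k < n) (k%:R ^+ 2 + 1)^-1 <= 6 - 6 / (n%:R + 1) :> R.
  by apply: (le_trans h); rewrite lerBlDr lerDl divr_ge0// addr_ge0.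
elim: n => [|n IH]; first by rewrite big_ord0 add0r divr1 subrr.
rewrite big_ord_recr /= -[n.+1%:R]natr1; apply: (le_trans (lerD IH (lexx _))).
set x : R := n%:R; have x0 : 0 <= x by rewrite ler0n.
have p1 : 0 < x ^+ 2 + 1 by rewrite ltr_wpDl// sqr_ge0.
have p2 : 0 < x + 1 by rewrite ltr_wpDl.
have p3 : 0 < x + 1 + 1 by rewrite ltr_wpDl// ltW.
suff : (x ^+ 2 + 1)^-1 <= 6 / (x + 1) - 6 / (x + 1 + 1) by lra.
have -> : 6 / (x + 1) - 6 / (x + 1 + 1) = 6 / ((x + 1) * (x + 1 + 1)).
  by field; rewrite !gt_eqF.
rewrite -div1r ler_pdivrMr// mulrAC ler_pdivlMr ?mulr_gt0// mul1r.
by nra.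
Qed.

(** Points are sorted by side [b], column [J] and level index [l]: there are 2 sides, m + 1 levels
    and at most N points in a cell, and G bounds the sum over the columns. *)
Lemma sum_by_cells (V : eqType) (r : seq V) (P : pred V) (f : V -> R)
    (b : V -> bool) (J l : V -> nat) (m N : nat) (g : nat -> R) (G : R) :
  (forall x, P x -> f x <= g (J x)) -> (forall x, P x -> (l x <= m)%N) ->
  (forall k, 0 <= g k) -> (forall n, \sum_(k < n) g k <= G) ->
  (forall c, (count (fun x => P x && ((b x, J x, l x) == c)) r <= N)%N) ->
  \sum_(x <- r | P x) f x <= 2 * m.+1%:R * N%:R * G.
Proof.
move=> fg lm g0 gG cellN.
(* Only finitely many columns occur in [r], so the cells can be indexed by a finite type. *)
pose n := (\max_(x <- r) J x)%N.
pose c x : bool * 'I_n.+1 * 'I_m.+1 := (b x, inord (J x), inord (l x)).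
have Jn x : x \in r -> (J x <= n)%N by move=> xr; exact: leq_bigmax_seq.
rewrite (partition_big c xpredT)//=.
apply: (@le_trans _ _ (\sum_(t : bool * 'I_n.+1 * 'I_m.+1) N%:R * g t.1.2)).
  apply: ler_sum => t _.
  rewrite big_seq_cond.
  apply: (@le_trans _ _ (\sum_(x <- r |
      P x && ((b x, J x, l x) == (t.1.1, t.1.2 : nat, t.2 : nat))) g t.1.2)).
    rewrite [leRHS]big_seq_cond.
    apply: (@le_trans _ _ (\sum_(x <- r | [&& x \in r, P x & c x == t]) g t.1.2)).
      apply: ler_sum => x /and3P[xr Px /eqP <-] /=.
      by rewrite inordK ?ltnS ?Jn// fg.
    rewrite le_eqVlt; apply/orP; left; apply/eqP; apply: eq_bigl => x.
    apply: andb_id2l => xr; apply: andb_id2l => Px.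
    case: t => -[t1 t2] t3; rewrite /c !xpair_eqE /=.
    by rewrite -!val_eqE /= !inordK ?ltnS ?Jn ?lm.
  rewrite big_const_seq iter_addr addr0 -[leLHS]mulr_natl ler_wpM2r// ler_nat.
  exact: cellN.
rewrite -mulr_sumr.
have -> : \sum_(t : bool * 'I_n.+1 * 'I_m.+1) g t.1.2 = 2 * m.+1%:R * \sum_(k < n.+1) g k.
  rewrite -(pair_bigA _ (fun (p : bool * 'I_n.+1) (_ : 'I_m.+1) => g p.2)) /=.
  rewrite -(pair_bigA _ (fun (_ : bool) (k : 'I_n.+1) => \sum_(_ < m.+1) g k)) /=.
  rewrite big_bool /=.
  under eq_bigr do rewrite sumr_const card_ord -mulr_natl.
  by rewrite -mulr_sumr; ring.
rewrite [leLHS]mulrA [N%:R * _]mulrC.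
by apply: ler_wpM2l; [rewrite !mulr_ge0|exact: gG].
Qed.

End Counting.

(** * The energy of the truncated logarithmic radius *)

Section Energy.
Variables (R : realType) (V : choiceType) (adj : rel V).
Hypothesis adj_sym : symmetric adj.
Hypothesis adj_conn : connected_graph adj.
Hypothesis adj_deg : bounded_degree adj.
Variables (phi : V -> hplane R) (c C : R).
Hypothesis c_gt0 : 0 < c.
Hypothesis phi_qi : forall x y,
  c * (gdist adj x y)%:R - C <= hdist (phi x) (phi y) <= C * (gdist adj x y)%:R + C.

(** Images in one cell are at bounded distance by [same_cell_near]; the lower quasi-isometry bound
    puts the vertices in a graph ball of fixed radius, of bounded size. *)
Lemma cell_capacity : exists N : nat, forall p (S : seq V), uniq S ->
  (forall x y, x \in S -> y \in S ->
    [/\ (p <= abscissa (phi x)) = (p <= abscissa (phi y)),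
      column p (phi x) = column p (phi y) & level (phi x) = level (phi y)]) ->
  (size S <= N)%N.
Proof.
pose D : R := ln (2 * (2 + expR 1 ^+ 2)).
have [N HN] := ball_growth adj_conn adj_deg (Num.truncn ((D + C) / c)).
exists N => p [//|x S] US same; apply: (HN x _ US) => y yS.
have [sg J k] := same x y (mem_head _ _) yS.
have hD : hdist (phi x) (phi y) <= D := same_cell_near sg J k.
have /andP[lo _] := phi_qi x y.
have h : (gdist adj x y)%:R <= (D + C) / c by rewrite ler_pdivlMr// mulrC; lra.
rewrite -ltnS -(ltr_nat R); apply: (le_lt_trans h); exact: truncnS_gt.
Qed.

Lemma weight_sum_in_annulus : exists2 K : R, 0 < K & forall (B : {fset V}) p A0 A1, A0 <= A1 ->
  \sum_(x <- B | A0 <= lograd p (phi x) <= A1) weight p (phi x) <= K * (A1 - A0 + 1).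
Proof.
have [N HN] := cell_capacity.
have h0 : 0 <= cell_height R.
  by rewrite divr_ge0// ln_ge0//; have := sqr_ge0 (expR 1 : R); lra.
pose e2 : R := expR 1 ^+ 2; have e20 : 0 < e2 by rewrite exprn_gt0// expR_gt0.
(* [N.+1] rather than [N] makes the constant positive. *)
pose K0 := 2 * (cell_height R + 2) * N.+1%:R * (6 * e2).
have K00 : 0 < K0 by rewrite !mulr_gt0//; lra.
exists K0 => // B p A0 A1 A01.
(* A lower bound for the levels that column J can have in the annulus. Levels are renumbered from
   it, column by column, so that fewer than [L] + 1 indices serve all columns. *)
pose k0 J : int := Num.floor (A0 - cell_height R - column_shift R J).
pose l x := `|level (phi x) - k0 (column p (phi x))|%N.
pose L := A1 - A0 + cell_height R + 1.
have L0 : 0 <= L by rewrite /L; lra.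
pose P x := A0 <= lograd p (phi x) <= A1.
have k0le x : P x -> k0 (column p (phi x)) <= level (phi x).
  move=> /andP[lo hi]; have /andP[_ ub] := lograd_cell p (phi x).
  rewrite -(ler_int R); apply: (le_trans (floor_le_tmp _)); lra.
have lE x : P x -> (l x)%:Z = level (phi x) - k0 (column p (phi x)).
  by move=> Px; rewrite /l gez0_abs// subr_ge0 k0le.
have lm x : P x -> (l x <= Num.truncn L)%N.
  move=> /[dup] Px /andP[lo hi]; rewrite -ltnS -(ltr_nat R).
  apply: (le_lt_trans _ (truncnS_gt L)).
  rewrite pmulrn lE// intrB.
  have /andP[lb _] := lograd_cell p (phi x).
  have := floorD1_gt (A0 - cell_height R - column_shift R (column p (phi x))).
  by rewrite intrD1 -/(k0 _) /L; lra.
clearbody l; have := @sum_by_cells R V B P (fun x => weight p (phi x))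
  (fun x => p <= abscissa (phi x)) (fun x => column p (phi x)) l (Num.truncn L) N
  (fun k => e2 * (k%:R ^+ 2 + 1)^-1) (6 * e2).
move=> H; apply: (le_trans (H _ lm _ _ _)).
- by move=> x _; exact: weight_le_column.
- by move=> k; rewrite mulr_ge0 ?(ltW e20)// invr_ge0 addr_ge0// sqr_ge0.
- by move=> n; rewrite -mulr_sumr mulrC ler_wpM2r ?(ltW e20)// sum_inv_sqr.
- move=> t; rewrite -size_filter; apply: (HN p).
    by rewrite filter_uniq// fset_uniq.
  move=> x y; rewrite !mem_filter => /andP[/andP[Px /eqP xt] _] /andP[/andP[Py /eqP yt] _].
  have e := etrans yt (esym xt).
  have lxy : l x = l y by exact: (esym (congr1 snd e)).
  have J : column p (phi x) = column p (phi y) by exact: (esym (congr1 (snd \o fst) e)).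
  split=> //; first exact: (esym (congr1 (fst \o fst) e)).
  by have := lE y Py; rewrite -lxy (lE x Px) J => /addIr.
have mL : (Num.truncn L).+1%:R <= L + 1.
  by rewrite -natr1 lerD2r; have /andP[] := truncn_itv L0.
have NN : N%:R <= N.+1%:R :> R by rewrite ler_nat.
have b1 : L + 1 <= (cell_height R + 2) * (A1 - A0 + 1) by rewrite /L; nra.
have b2 : (Num.truncn L).+1%:R <= (cell_height R + 2) * (A1 - A0 + 1) by lra.
have b3 : (Num.truncn L).+1%:R * N%:R <= (cell_height R + 2) * (A1 - A0 + 1) * N.+1%:R.
  by rewrite ler_pM.
rewrite [leLHS](_ : _ = (12 * e2) * ((Num.truncn L).+1%:R * N%:R)); last by ring.
rewrite [leRHS](_ : _ = (12 * e2) * ((cell_height R + 2) * (A1 - A0 + 1) * N.+1%:R)).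
  by rewrite ler_wpM2l ?mulr_ge0 ?(ltW e20).
by rewrite /K0; ring.
Qed.

Definition clip (A0 A1 t : R) : R := Num.min (Num.max t A0) A1.

Lemma clip_id A0 A1 t : A0 <= t <= A1 -> clip A0 A1 t = t.
Proof. by move=> /andP[h0 h1]; rewrite /clip (max_idPl h0) (min_idPl h1). Qed.

Lemma clip_below A0 A1 t : A0 <= A1 -> t <= A0 -> clip A0 A1 t = A0.
Proof. by move=> A01 tA; rewrite /clip (max_idPr tA) (min_idPl A01). Qed.

Lemma clip_above A0 A1 t : A1 <= t -> clip A0 A1 t = A1.
Proof. by move=> tA; apply/min_idPr; rewrite le_max tA. Qed.

Lemma clip_contract A0 A1 s t : A0 <= A1 -> (clip A0 A1 s - clip A0 A1 t) ^+ 2 <= (s - t) ^+ 2.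
Proof.
move=> A01.
wlog st : s t / s <= t => [hw|].
  have [/hw//|/ltW/hw] := leP s t.
  by rewrite -sqrrN opprB -(sqrrN (s - t)) opprB.
suff /andP[h1 h2] : 0 <= clip A0 A1 t - clip A0 A1 s <= t - s.
  by rewrite -sqrrN opprB -(sqrrN (s - t)) opprB ler_sqr ?nnegrE// (le_trans h1).
have [sA|/ltW sA] := leP s A0.
  rewrite (clip_below A01 sA); have [tA|/ltW tA] := leP t A0.
    by rewrite (clip_below A01 tA); lra.
  have [tA1|/ltW tA1] := leP t A1; first by rewrite clip_id ?tA//; lra.
  by rewrite clip_above//; lra.
have tA : A0 <= t by lra.
have [tA1|/ltW tA1] := leP t A1.
  by rewrite !clip_id ?tA ?sA//; lra.
rewrite [clip A0 A1 t]clip_above//; have [sA1|/ltW sA1] := leP s A1.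
  by rewrite clip_id ?sA//; lra.
by rewrite clip_above//; lra.
Qed.

(** Both values lie on the same side of [A0, A1], so an edge with an end point outside the widened
    annulus carries no energy. *)
Lemma clip_eq A0 A1 s t M : A0 <= A1 -> `|s - t| <= M -> ~~ (A0 - M <= s <= A1 + M) ->
  clip A0 A1 s = clip A0 A1 t.
Proof.
move=> A01; rewrite ler_norml negb_and -!ltNge => /andP[h1 h2] /orP[h|h].
  have hs : s <= A0 by lra.
  have ht : t <= A0 by lra.
  by rewrite !clip_below.
have hs : A1 <= s by lra.
have ht : A1 <= t by lra.
by rewrite !clip_above.
Qed.

(** Edges with both ends in the widened annulus cost at most a multiple of the weights of their
    ends, the others nothing. As degrees are bounded, [weight_sum_in_annulus] bounds the total,
    uniformly in [B]. *)
Lemma clip_energy : exists2 K : R, 0 < K & forall p A0 A1, A0 <= A1 ->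
  (forall x y, adj x y ->
    `|clip A0 A1 (lograd p (phi x)) - clip A0 A1 (lograd p (phi y))| <= K) /\
  forall B : {fset V}, \sum_(x <- B) \sum_(y <- B | adj x y)
    (clip A0 A1 (lograd p (phi x)) - clip A0 A1 (lograd p (phi y))) ^+ 2
    <= K * (A1 - A0 + 1).
Proof.
have [K K0 HK] := weight_sum_in_annulus.
have [D [nb nbP]] := neighbour_seq adj_deg.
(* Adjacent vertices have images at distance at most 2 * |C|; [k] and [M] are the constants of
   [lograd_edge] and [lograd_edge_norm] for this distance. *)
pose k := 2 * expR (2 * `|C|); pose M := 2 * k.
have k0 : 0 < k by rewrite mulr_gt0// expR_gt0.
have M0 : 0 <= M by rewrite mulr_ge0// ltW.
have edge x y : adj x y -> hdist (phi x) (phi y) <= 2 * `|C|.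
  move=> xy; have /andP[_ hi] := phi_qi x y; apply: (le_trans hi).
  have g1 : (gdist adj x y)%:R <= 1 :> R by rewrite lern1 gdist_adj.
  have g0 : 0 <= (gdist adj x y)%:R :> R by rewrite ler0n.
  have := ler_norm C; have := normr_ge0 C; nra.
pose K1 := M + 2 * D%:R * k ^+ 2 * (K * (2 * M + 1)).
exists (K1 + 1).
  rewrite ltr_wpDl// addr_ge0// !mulr_ge0 ?sqr_ge0 ?(ltW K0)// addr_ge0// mulr_ge0//.
move=> p A0 A1 A01.
set b := fun x => clip A0 A1 (lograd p (phi x)).
have K1M : M <= K1.
  rewrite lerDl !mulr_ge0 ?sqr_ge0 ?(ltW K0)// addr_ge0// mulr_ge0//.
have norm_edge x y : adj x y -> `|lograd p (phi x) - lograd p (phi y)| <= M.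
  by move=> /edge; exact: lograd_edge_norm.
split=> [x y xy|B].
  apply: (@le_trans _ _ M); last by lra.
  apply: le_trans (norm_edge _ _ xy).
  by have := clip_contract (lograd p (phi x)) (lograd p (phi y)) A01;
    rewrite -real_normK ?num_real// -[leRHS]real_normK ?num_real// ler_sqr ?nnegrE.
pose I x := A0 - M <= lograd p (phi x) <= A1 + M.
pose h x := if I x then weight p (phi x) else 0.
have h0 x : 0 <= h x by rewrite /h; case: ifP => // _; exact: weight_ge0.
have edge_le x y : adj x y -> (b x - b y) ^+ 2 <= k ^+ 2 * (h x + h y).
  move=> xy; have hx := clip_eq A01 (norm_edge _ _ xy).
  have yx : adj y x by rewrite adj_sym.
  have hy := clip_eq A01 (norm_edge _ _ yx).
  have hh : 0 <= k ^+ 2 * (h x + h y) by rewrite mulr_ge0 ?sqr_ge0 ?addr_ge0.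
  have [Ix|/hx e] := boolP (I x); last by rewrite /b e subrr expr0n.
  have [Iy|/hy e] := boolP (I y); last by rewrite /b -e subrr expr0n.
  apply: (le_trans (clip_contract _ _ A01)); rewrite /h Ix Iy.
  exact: lograd_edge (edge _ _ xy).
have deg x (t : R) : 0 <= t -> \sum_(y <- B | adj x y) t <= D%:R * t.
  move=> t0; rewrite big_const_seq iter_addr addr0 -[leLHS]mulr_natl ler_wpM2r// ler_nat.
  have [nbD nbin] := nbP x; apply: leq_trans nbD; rewrite -size_filter.
  apply: uniq_leq_size; first by rewrite filter_uniq// fset_uniq.
  by move=> y; rewrite mem_filter => /andP[/nbin].
have sumh : \sum_(x <- B) h x <= K * (2 * M + 1) * (A1 - A0 + 1).
  rewrite /h -big_mkcond/=; have A01' : A0 - M <= A1 + M by lra.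
  apply: (le_trans (HK B p _ _ A01')); rewrite -mulrA ler_wpM2l ?(ltW K0)//.
  by nra.
have half : \sum_(x <- B) \sum_(y <- B | adj x y) h x <= D%:R * \sum_(x <- B) h x.
  by rewrite mulr_sumr; apply: ler_sum => x _; exact: deg.
apply: (@le_trans _ _ (k ^+ 2 * (2 * (D%:R * \sum_(x <- B) h x)))).
  apply: (@le_trans _ _ (\sum_(x <- B) \sum_(y <- B | adj x y) k ^+ 2 * (h x + h y))).
    by apply: ler_sum => x _; apply: ler_sum => y; exact: edge_le.
  under eq_bigr do rewrite -mulr_sumr big_split /=.
  rewrite -mulr_sumr ler_wpM2l ?sqr_ge0// big_split /= mulrDl !mul1r lerD//.
  rewrite (exchange_big_dep xpredT)//=.
  by under eq_bigr do under eq_bigl do rewrite adj_sym.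
have : k ^+ 2 * (2 * (D%:R * \sum_(x <- B) h x)) <=
    k ^+ 2 * (2 * (D%:R * (K * (2 * M + 1) * (A1 - A0 + 1)))).
  by rewrite ler_wpM2l ?sqr_ge0// ler_wpM2l// ler_wpM2l.
move=> h1; apply: (le_trans h1).
have a1 : 0 <= (M + 1) * (A1 - A0 + 1) by rewrite mulr_ge0//; lra.
rewrite /K1 (_ : (_ + 1) * _ = (M + 1) * (A1 - A0 + 1) +
  k ^+ 2 * (2 * (D%:R * (K * (2 * M + 1) * (A1 - A0 + 1))))); last by ring.
by rewrite lerDr.
Qed.

End Energy.

(** * Choice of the rotation and conclusion *)

Lemma limn_esup_le_ub (R : realType) (u : (\bar R)^nat) (l : \bar R) :
  (forall k, (u k <= l)%E) -> (limn_esup u <= l)%E.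
Proof.
move=> ul; rewrite limn_esup_lim; apply: lime_le; first exact: is_cvg_esups.
by apply: nearW => k; apply: ge_ereal_sup => _ [m _ <-].
Qed.

Lemma ch_taylor1 (R : realType) (t : R) : `|t| <= 1 -> ch t - 1 <= expR 1 * t ^+ 2.
Proof.
move=> t1; have e1 : expR `|t| <= expR 1 by rewrite ler_expR.
have e2 : expR `|t| * t ^+ 2 <= expR 1 * t ^+ 2 by rewrite ler_wpM2r ?sqr_ge0.
have := expR_taylor1 t; have := expR_taylor1 (- t); rewrite normrN sqrrN.
rewrite !ler_norml => /andP[_ h1] /andP[_ h2]; rewrite /ch; lra.
Qed.

Theorem mainTheorem1 (R : realType) (V : choiceType) (adj : rel V)
  (adj_sym : symmetric adj) (adj_irr : irreflexive adj)
  (adj_conn : connected_graph adj) (adj_deg : bounded_degree adj)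
  (adj_qi : quasi_isometric (fun u v : V => (gdist adj u v)%:R) (@hdist R))
  (o : V) (n : nat) (n_ge2 : (2 <= n)%N)
  (sigma : probability (spin R n) R) (sigma_unif : uniform_on_sphere sigma)
  (beta : R) (beta_gt0 : 0 < beta) :
  exists K kappa : R, 0 < kappa /\
    forall u v : V,
      (abs_pair_correlation adj sigma o beta u v
         <= (K * expR (- kappa * (gdist adj u v)%:R))%:E)%E.
Proof.
have [phi [c [C [c0 C0 phi_qi _]]]] := adj_qi.
have [K K0 HK] := clip_energy adj_sym adj_conn adj_deg c0 phi_qi.
pose E : R := expR 1; have E0 : 0 < E := expR_gt0 1.
have d0 : 0 < 1 + 2 * beta * E by rewrite ltr_wpDr// !mulr_ge0// ltW.
(* The slope is small enough for two purposes: k * K <= 1 keeps the increments on edges in the range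
   of [ch_taylor1], and beta * E * k * K <= 1/2 lets the energy consume at most half of the linear
   gain, up to a constant. *)
pose k := (K * (1 + 2 * beta * E))^-1.
have k0 : 0 < k by rewrite invr_gt0 mulr_gt0.
have kK : k * K * (1 + 2 * beta * E) = 1.
  by rewrite /k -mulrA mulVf// gt_eqF// mulr_gt0.
have bE0 : 0 < beta * E by rewrite mulr_gt0.
have kK0 : 0 < k * K by rewrite mulr_gt0.
have kK1 : k * K <= 1 by nra.
have kKb : beta * E * (k * K) <= 1 / 2 by nra.
(* The exponent is at most - k / 2 * (A1 - A0) + k / 2, and A1 - A0 >= (c * d(u, v) - C - ln 6) / 2
   by [lograd_separates] and the quasi-isometry. *)
exists (2 * n%:R * expR (k / 4 * (C + ln 6) + k / 2)), (k * c / 4).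
split; first by rewrite divr_gt0// mulr_gt0.
move=> u v; apply: limn_esup_le_ub => r; rewrite lee_fin.
have [p sep] := lograd_separates (phi u) (phi v).
set tu := lograd p (phi u) in sep; set tv := lograd p (phi v) in sep.
pose A0 := Num.min tu tv; pose A1 := Num.max tu tv.
have A01 : A0 <= A1 by rewrite ge_min !le_max lexx.
have [edge energy] := HK p A0 A1 A01.
pose b x := clip A0 A1 (lograd p (phi x)).
have bu : b u = tu by apply: clip_id; rewrite ge_min le_max !lexx.
have bv : b v = tv by apply: clip_id; rewrite ge_min le_max !lexx !orbT.
(* The sign makes a u - a v nonnegative whichever of the two points has the larger radius. *)
pose a x := (if tv <= tu then k else - k) * b x.
have auv : a u - a v = k * (A1 - A0).
  rewrite /a bu bv /A0 /A1; by case: (leP tv tu) => h; ring.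
have A10 : A1 - A0 = `|tu - tv|.
  rewrite /A0 /A1; case: (leP tv tu) => h.
    by rewrite ger0_norm// subr_ge0.
  by rewrite ltr0_norm ?subr_lt0// opprB.
have asq x y : (a x - a y) ^+ 2 = k ^+ 2 * (b x - b y) ^+ 2.
  by rewrite /a; case: ifP => _; ring.
have small x y : adj x y -> `|a x - a y| <= 1.
  move=> xy; have := edge x y xy; rewrite -/(b x) -/(b y) => bK.
  rewrite /a -mulrBr normrM (_ : `|if _ then _ else _| = k); last first.
    by case: ifP => _; rewrite ?normrN gtr0_norm.
  by apply: le_trans kK1; rewrite ler_wpM2l// ltW.
apply: (le_trans (ball_correlation_bound adj sigma_unif o a u v r n_ge2 beta_gt0)).
set S := \sum_(x <- _) _.
have SE : S <= E * (k ^+ 2 * (K * (A1 - A0 + 1))).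
  apply: (@le_trans _ _ (\sum_(x <- gball adj o r) \sum_(y <- gball adj o r | adj x y)
      E * (k ^+ 2 * (b x - b y) ^+ 2))).
    by apply: ler_sum => x _; apply: ler_sum => y xy; rewrite -asq ch_taylor1 ?small.
  under eq_bigr do rewrite -mulr_sumr -mulr_sumr.
  by rewrite -mulr_sumr -mulr_sumr ler_wpM2l ?(ltW E0)// ler_wpM2l ?sqr_ge0.
rewrite -[leRHS]mulrA ler_wpM2l// -expRD ler_expR auv.
have /andP[lo _] := phi_qi u v.
set g := (gdist adj u v)%:R in lo *.
have D0 : 0 <= A1 - A0 + 1 by lra.
have bS : beta * S <= k / 2 * (A1 - A0 + 1).
  apply: (@le_trans _ _ (beta * (E * (k ^+ 2 * (K * (A1 - A0 + 1)))))).
    by rewrite ler_wpM2l// ltW.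
  rewrite (_ : beta * _ = (beta * E * (k * K)) * (k * (A1 - A0 + 1))); last by ring.
  rewrite (_ : k / 2 * _ = 1 / 2 * (k * (A1 - A0 + 1))); last by field.
  by rewrite ler_wpM2r// mulr_ge0// ltW.
have gap : k * (c * g) <= k * (C + ln 6 + 2 * (A1 - A0)).
  by rewrite ler_wpM2l ?(ltW k0)// A10; lra.
by lra.
Qed.
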